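(* Let $I$ be a compact interval and $(X,d)$ a compact length space. Suppose that $\mathcal F$ is a family of continuous functions $I\to(0,\infty)$ that is uniformly bounded above: there is $C>0$ such that $f(t)\le C$ for all $t\in I$ and all $f\in\mathcal F$. Then $\mathcal Y:=\{(I\times_f X,\hat d_f)\mid f\in\mathcal F\}$ is precompact with respect to the Gromov-Hausdorff topology. Thus any sequence from $\mathcal Y$ possesses a subsequence that converges in the Gromov-Hausdorff sense.
   Context: Length space: a metric space $(X,d)$ in which $d(x,y)$ is the infimum of the $d$-lengths of curves joining $x$ and $y$; it is assumed throughout that any two points can be joined by a curve of finite length. Generalized cone: let $I\subseteq\mathbb R$ be a nondegenerate interval and $f:I\to(0,\infty)$ continuous. The generalized cone $Y=I\times_f X$ is the set $I\times X$ with the product metric $D((t,x),(t',x'))=|t-t'|+d(x,x')$ and the following causal structure. A curve $\gamma=(\alpha,\beta):J\to Y$ on an interval $J$, with $\alpha:J\to I$ and $\beta:J\to X$ absolutely continuous and $\alpha$ strictly monotone, is causal if $-\dot\alpha^2+(f\circ\alpha)^2v_\beta^2\le 0$ almost everywhere, where $v_\beta$ is the metric derivative of $\beta$; it is future (past) directed causal if moreover $\dot\alpha>0$ ($\dot\alpha<0$) a.e. Null distance: a curve $\beta:[a,b]\to Y$ is piecewise causal if there is a partition $a=s_0<\dots<s_k=b$ such that each $\beta|_{[s_{i-1},s_i]}$ is constant, future directed causal or past directed causal. With the time function $t:Y\to\mathbb R$, $t(s,x)=s$, its null length is $\hat L_t(\beta)=\sum_{i=1}^k|t(\beta(s_i))-t(\beta(s_{i-1}))|$,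 and $\hat d_f(p,q)$ is the infimum of $\hat L_t(\beta)$ over all piecewise causal curves $\beta$ from $p$ to $q$. (Here $I$ and $X$ are compact, and $(I\times_fX,\hat d_f)$ is regarded as a metric space.) *)

(* Defs.v *)
From mathcomp Require Import all_boot all_order all_algebra.
From mathcomp Require Import all_classical all_reals all_analysis.

Set Implicit Arguments.
Unset Strict Implicit.
Unset Printing Implicit Defensive.

Import Order.TTheory GRing.Theory Num.Theory.
Import numFieldNormedType.Exports.

Local Open Scope classical_set_scope.
Local Open Scope ring_scope.

(* A curve defined on [u, v] is represented by a total function on R; only its
   values on [u, v] are used. *)

Section curves.
Context {R : realType} {X : metricType R}.

Definition curve_variation (u v : R) (c : R -> X) (s : seq R) : R :=
  let F := c \o nth v (u :: s) in
  \sum_(0 <= n < size s) mdist (F n) (F n.+1).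

Definition curve_length (u v : R) (c : R -> X) : \bar R :=
  ereal_sup [set (curve_variation u v c s)%:E | s in itv_partition u v].

Definition abs_continuous (u v : R) (c : R -> X) : Prop :=
  forall e : R, 0 < e -> exists2 d : R, 0 < d &
    forall (n : nat) (x y : 'I_n -> R),
      (forall i, [/\ u <= x i, x i <= y i & y i <= v]) ->
      trivIset setT (fun i => `]x i, y i[%classic) ->
      \sum_(i < n) (y i - x i) < d ->
      \sum_(i < n) mdist (c (x i)) (c (y i)) < e.

Definition is_metric_derivative (c : R -> X) (s w : R) : Prop :=
  (fun h : R => mdist (c (s + h)) (c s) / `|h|) @ 0^' --> w.

End curves.

(* Since mdist x y is finite, the equality below also says that x and y can be
   joined by a curve of finite length. *)
Definition length_space {R : realType} (X : metricType R) : Prop :=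
  forall x y : X, (mdist x y)%:E =
    ereal_inf [set l : \bar R | exists (u v : R) (c : R -> X),
      [/\ u < v, {within `[u, v], continuous c}, c u = x, c v = y
        & l = curve_length u v c]].

Section generalized_cones.
Context {R : realType} {X : metricType R}.

Definition strictly_monotone (u v : R) (al : R -> R) : Prop :=
  {in `[u, v] &, {homo al : s t / s < t}} \/
  {in `[u, v] &, {homo al : s t /~ s < t}}.

Definition causal (f : R -> R) (u v : R) (al : R -> R) (be : R -> X) : Prop :=
  [/\ abs_continuous u v (al : R -> R^o), abs_continuous u v be,
      strictly_monotone u v al
    & {ae lebesgue_measure, forall s : R, s \in `]u, v[ ->
        exists a' w : R, [/\ is_derive s 1 al a', is_metric_derivative be s w
          & - a' ^+ 2 + f (al s) ^+ 2 * w ^+ 2 <= 0]}].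

Definition future_causal f (u v : R) (al : R -> R) (be : R -> X) : Prop :=
  causal f u v al be /\
  {ae lebesgue_measure, forall s : R, s \in `]u, v[ ->
    exists2 a' : R, is_derive s 1 al a' & 0 < a'}.

Definition past_causal f (u v : R) (al : R -> R) (be : R -> X) : Prop :=
  causal f u v al be /\
  {ae lebesgue_measure, forall s : R, s \in `]u, v[ ->
    exists2 a' : R, is_derive s 1 al a' & a' < 0}.

Definition constant_curve (u v : R) (al : R -> R) (be : R -> X) : Prop :=
  {in `[u, v], forall s, al s = al u /\ be s = be u}.

(* s lists the partition points other than the first one, u *)
Definition piecewise_causal_on f (u v : R) (s : seq R)
    (al : R -> R) (be : R -> X) : Prop :=
  itv_partition u v s /\
  forall i : nat, (i < size s)%N ->
    let x := nth v (u :: s) i in let y := nth v (u :: s) i.+1 in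
    [\/ constant_curve x y al be, future_causal f x y al be
      | past_causal f x y al be].

(* The underlying set I * X of the generalized cone, for I = [a, b] *)
Definition cone (a b : R) : Type := (`[a, b]%classic * X)%type.

(* The null length of (al, be) is the variation along the partition s of its
   time component al. *)
Definition null_dist (a b : R) (f : R -> R) (p q : cone a b) : \bar R :=
  ereal_inf [set l : \bar R |
    exists (u v : R) (s : seq R) (al : R -> R) (be : R -> X),
      [/\ u < v, {in `[u, v], forall t, al t \in `[a, b]},
          piecewise_causal_on f u v s al be,
          [/\ al u = val p.1, be u = p.2, al v = val q.1 & be v = q.2]
        & l = (variation u v al s)%:E]].

End generalized_cones.

Arguments cone {R} X a b.

Section gromov_hausdorff.
Context {R : realType}.

Definition hausdorff_dist (Z : metricType R) (S T : set Z) : \bar R :=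
  ereal_inf [set r%:E | r in [set r : R |
    [/\ 0 < r, S `<=` \bigcup_(x in T) ball x r
      & T `<=` \bigcup_(x in S) ball x r]]].

Definition isometric_embedding (A Z : metricType R) (phi : A -> Z) : Prop :=
  forall x y, mdist (phi x) (phi y) = mdist x y.

Definition gh_dist (A B : metricType R) : \bar R :=
  ereal_inf [set l : \bar R |
    exists (Z : metricType R) (phi : A -> Z) (psi : B -> Z),
      [/\ isometric_embedding phi, isometric_embedding psi
        & l = hausdorff_dist (range phi) (range psi)]].

End gromov_hausdorff.

(* Isometric spaces are not identified: they are at distance 0, hence
   topologically indistinguishable. *)
Record compact_metric (R : realType) := CompactMetric {
  cm_sort :> metricType R ;
  cm_compact : compact [set: cm_sort] }.

(* compact_metric R lives in a universe too large for set and topologicalType,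
   so the topology induced by gh_dist is spelled out with plain predicates. *)
Section gromov_hausdorff_topology.
Context {R : realType}.
Implicit Types U S K : compact_metric R -> Prop.

Definition gh_open U : Prop :=
  forall A, U A -> exists2 e : R, 0 < e &
    forall B : compact_metric R, (gh_dist A B < e%:E)%E -> U B.

Definition gh_closure S (A : compact_metric R) : Prop :=
  forall U, gh_open U -> U A -> exists2 B, S B & U B.

Definition gh_compact K : Prop :=
  forall C : (compact_metric R -> Prop) -> Prop,
    (forall U, C U -> gh_open U) ->
    (forall A, K A -> exists2 U, C U & U A) ->
    exists (n : nat) (V : 'I_n -> compact_metric R -> Prop),
      (forall i, C (V i)) /\ (forall A, K A -> exists i, V i A).

Definition gh_precompact S : Prop := gh_compact (gh_closure S).

End gromov_hausdorff_topology.

(* (I x_f X, null_dist f) is a compact metric space isometric to A *)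
Definition is_cone_space {R : realType} (X : metricType R) (a b : R)
    (f : R -> R) (A : compact_metric R) : Prop :=
  exists2 phi : cone X a b -> A, bijective phi &
    forall p q, (mdist (phi p) (phi q))%:E = null_dist f p q.

Definition cone_spaces {R : realType} (X : metricType R) (a b : R)
    (F : set (R -> R)) (A : compact_metric R) : Prop :=
  exists2 f, F f & is_cone_space X a b f A.

(* Main.v *)
From HB Require Import structures.
Require Import Defs.
From mathcomp Require Import all_boot all_order all_algebra.
From mathcomp Require Import all_classical all_reals all_analysis.
From mathcomp Require Import measurable_realfun lra.

(** The spaces in question are all images of one set, I * X, under maps that
    are 1-Lipschitz for one and the same pseudo-distance
    [cone_dist C p q = |t(q) - t(p)| + 2 C d(x(p), x(q))], for which I * X is
    compact. Everything about precompactness follows from this.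

    The Lipschitz bound. A compact length space is geodesic ([geodesic]).
    Travelling along a geodesic of X at constant speed while the time moves
    linearly by at least C times the distance covered is causal for every f
    bounded by C ([hop_of_dist_le]). Zigzagging in time along a geodesic hence
    joins (t, x) to (t, y) with null length 2 C d(x, y), whatever f is, and a
    vertical segment then corrects the time ([null_chain_exists]). The zigzag
    may need many teeth because the time has to stay in I.

    The null distance is a distance. Along a causal curve the speed of the
    space component is at most the speed of time divided by the minimum m of
    f, so that null lengths bound m times distances in X from above
    ([null_chain_ge]). Going from the almost everywhere inequality to
    increments uses absolute continuity ([speed_bound]): Cousin's lemma covers
    the interval by small tagged subintervals, and those tagged at exceptional
    points lie in an open set of small measure. Symmetry and the triangle
    inequality come from the description of the null distance by finite chains
    of points ([null_distE]), where concatenation is concatenation of lists.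

    Precompactness. For a compact pseudo-metric space (T, D), let K be the
    class of compact metric spaces that are 1-Lipschitz images of T. Such an
    image is determined by the pseudo-distance it induces on T; these
    pseudo-distances form an equicontinuous family, for which pointwise and
    uniform limits along ultrafilters coincide ([pseudo_dist_ultralimit]), and
    uniformly close pseudo-distances have quotients that are close in the sense
    of Gromov and Hausdorff ([gh_dist_le]). So K is compact, and it is closed
    because an ultralimit of approximate 1-Lipschitz surjections onto a compact
    space is one ([short_quotient_closed]). Closed subclasses of K are compact,
    and every sequence in K has a convergent subsequence. *)

Set Implicit Arguments.
Unset Strict Implicit.
Unset Printing Implicit Defensive.

Import Order.TTheory GRing.Theory Num.Theory.
Import numFieldNormedType.Exports.

Local Open Scope classical_set_scope.
Local Open Scope ring_scope.

(** * The metric space associated with a pseudo-distance *)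

Record pseudo_dist {R : realType} (T : Type) (d : T -> T -> R) : Prop :=
  PseudoDist {
    pd_refl : forall x, d x x = 0 ;
    pd_sym : forall x y, d x y = d y x ;
    pd_triangle : forall y x z, d x z <= d x y + d y z }.

Section metric_quotient.
Context {R : realType} {T : Type} (d : T -> T -> R).

(** The points are the classes of elements at distance zero, encoded as sets, so
    that two of them are equal as soon as they have the same elements. *)
Definition metric_quotient of pseudo_dist d : Type :=
  {S : set T | exists x, S = [set y | d x y = 0]}.

Hypothesis dP : pseudo_dist d.
Local Notation Q := (metric_quotient dP).

Definition quotient_proj (x : T) : Q :=
  exist _ [set y | d x y = 0] (ex_intro _ x erefl).

Definition quotient_repr (A : Q) : T := sval (cid (svalP A)).

Definition quotient_dist (A B : Q) : R := d (quotient_repr A) (quotient_repr B).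

Lemma pd_ge0 x y : 0 <= d x y.
Proof.
have := pd_triangle dP y x x.
by rewrite (pd_refl dP) (pd_sym dP y) -mulr2n pmulrn_lge0.
Qed.

Lemma pd_eq0 x x' y : d x x' = 0 -> d x y = d x' y.
Proof.
move=> xx'; apply/eqP; rewrite eq_le.
have := pd_triangle dP x' x y; have := pd_triangle dP x x' y.
by rewrite (pd_sym dP x' x) xx' !add0r => -> ->.
Qed.

Lemma quotient_ext (A B : Q) : sval A = sval B -> A = B.
Proof.
case: A B => [S hS] [S' hS'] /= e; case: S' / e hS' => hS'.
by congr exist; exact: Prop_irrelevance.
Qed.

Lemma quotient_reprK A : quotient_proj (quotient_repr A) = A.
Proof.
apply: quotient_ext => /=.
by rewrite /quotient_repr; case: cid => x /= <-.
Qed.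

Lemma quotient_proj_repr x : d x (quotient_repr (quotient_proj x)) = 0.
Proof.
set A := quotient_proj x.
have /(congr1 sval)/= e := quotient_reprK A.
suff: [set y | d x y = 0] (quotient_repr A) by [].
by rewrite -e /= (pd_refl dP).
Qed.

Lemma quotient_dist_proj x y :
  quotient_dist (quotient_proj x) (quotient_proj y) = d x y.
Proof.
rewrite /quotient_dist -(pd_eq0 _ (quotient_proj_repr x)) (pd_sym dP).
by rewrite -(pd_eq0 _ (quotient_proj_repr y)) (pd_sym dP).
Qed.

Lemma quotient_dist_eq0 A B : quotient_dist A B = 0 -> A = B.
Proof.
move=> AB; rewrite -(quotient_reprK A) -(quotient_reprK B).
apply: quotient_ext; apply/seteqP; split=> y /=; first by rewrite (pd_eq0 _ AB).
by rewrite -(pd_eq0 _ AB).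
Qed.

HB.instance Definition _ := gen_eqMixin Q.
HB.instance Definition _ := gen_choiceMixin Q.
HB.instance Definition _ := @isMetric.Build R Q quotient_dist
  (fun A => pd_refl dP (quotient_repr A)) quotient_dist_eq0
  (fun A B => pd_sym dP _ _) (fun B A C => pd_triangle dP _ _ _).

End metric_quotient.

(** Spaces given by an explicit distance (cones with the null distance, their
    limits, ambient spaces for Gromov-Hausdorff estimates) are built here. *)
Lemma metric_of_pseudo_dist {R : realType} {T : Type} (d : T -> T -> R) :
  pseudo_dist d -> exists (Q : metricType R) (pi : T -> Q),
    (forall A, exists x, pi x = A) /\
    (forall x y, mdist (pi x) (pi y) = d x y).
Proof.
move=> dP; exists (metric_quotient dP), (quotient_proj dP); split.
  by move=> A; exists (quotient_repr A); exact: quotient_reprK.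
exact: quotient_dist_proj.
Qed.

(** * Ultralimits of pseudo-distances *)

Section ultrafilters.

(** The image of an ultrafilter is maximal since every set or its complement
    has its preimage in the ultrafilter. *)
Lemma ultra_fmap {J S : Type} (h : J -> S) (U : set_system J) :
  UltraFilter U -> UltraFilter (h @ U).
Proof.
move=> UU; split; first exact: fmap_proper_filter.
move=> G GF UG; apply/seteqP; split; last exact: UG.
move=> A GA; have [//|UnA] := in_ultra_setVsetC (h @^-1` A) UU.
have /UG GnA : (h @ U) (~` A) by [].
by have /filter_ex[x []] : G (A `&` ~` A) by exact: filterI.
Qed.

Lemma ultra_cvg_compact {J : Type} {S : topologicalType} (K : set S) (h : J -> S)
    (U : set_system J) : UltraFilter U -> compact K -> (forall j, K (h j)) ->
  exists2 x, K x & h @ U --> x.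
Proof.
move=> UU; rewrite compact_ultra => Kc Kh.
have [||x [Kx hx]] := Kc (h @ U); first exact: ultra_fmap.
  exact: (@filterE _ U _ (h @^-1` K) Kh).
by exists x.
Qed.

End ultrafilters.

Lemma cvg_mdist {R : realType} {J : Type} {S : metricType R} (h : J -> S)
    (U : set_system J) {FU : Filter U} (x : S) : h @ U --> x ->
  forall e, 0 < e -> \forall j \near U, mdist (h j) x < e.
Proof.
move=> hx e e0.
have : nbhs x (ball x e) by exact: nbhsx_ballx.
move=> /hx; rewrite /nbhs/=; apply: filterS => j /=.
by rewrite ballEmdist/= metric_sym.
Qed.

(** Compactness for a pseudo-distance, phrased with ultrafilters so that no
    topology has to be put on [T]. *)
Definition dist_compact {R : realType} {T : Type} (D : T -> T -> R) : Prop :=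
  forall U : set_system T, UltraFilter U ->
    exists x, forall e, 0 < e -> \forall y \near U, D y x < e.

(** A short map is a 1-Lipschitz map; here it is also onto. *)
Definition short_image {R : realType} {T : Type} (D : T -> T -> R)
    (A : metricType R) (pi : T -> A) : Prop :=
  (forall a, exists x, pi x = a) /\ (forall x y, mdist (pi x) (pi y) <= D x y).

Section short_images.
Context {R : realType} {T : Type} (D : T -> T -> R).
Hypothesis Dc : dist_compact D.

Lemma dist_compact_lim {J : Type} (U : set_system J) (h : J -> T) :
  UltraFilter U ->
  exists x, forall e, 0 < e -> \forall j \near U, D (h j) x < e.
Proof. by move=> UU; exact: (Dc (ultra_fmap h UU)). Qed.

Lemma short_image_compact (A : metricType R) (pi : T -> A) :
  short_image D pi -> compact [set: A].
Proof.
move=> [/choice[s sK] piD]; rewrite compact_ultra => U UU _.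
have [x xU] := dist_compact_lim s UU.
exists (pi x); split => //; apply/cvg_ballP => e e0.
near=> a; rewrite ballEmdist /= metric_sym -(sK a).
by rewrite (le_lt_trans (piD _ _))//; near: a; exact: xU.
Unshelve. all: by end_near. Qed.

(** This is the Arzela-Ascoli theorem for pseudo-distances dominated by [D].
    Pointwise limits exist because the values at (x, y) stay in the segment
    [0, D x y]. Convergence is uniform because the domination makes the family
    equicontinuous and [T] is compact. *)
Lemma pseudo_dist_ultralimit {J : Type} (U : set_system J)
    (rho : J -> T -> T -> R) :
  UltraFilter U -> (forall j, pseudo_dist (rho j)) ->
  (forall j x y, rho j x y <= D x y) ->
  exists rho', [/\ pseudo_dist rho', forall x y, rho' x y <= D x y
    & forall e, 0 < e -> \forall j \near U, forall x y,
        `|rho j x y - rho' x y| <= e].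
Proof.
move=> UU rhoP rhoD.
have lim x y : exists l : R, (fun j => rho j x y) @ U --> l.
  have [||l _ hl] := @ultra_cvg_compact J R `[0, D x y]%classic
      (fun j => rho j x y) U UU; first exact: segment_compact.
    by move=> j; rewrite /= in_itv/= (pd_ge0 (rhoP j)) rhoD.
  by exists l.
have limx x : exists r : T -> R, forall y, (fun j => rho j x y) @ U --> r y.
  by have /choice[r rE] := lim x; exists r.
have /choice[rho' rho'E] := limx.
have rho'le x y e : 0 < e -> \forall j \near U, `|rho j x y - rho' x y| < e.
  by move=> e0; move/cvgrPdistC_lt : (rho'E x y) => /(_ _ e0).
have rho'P : pseudo_dist rho'.
  split.
  - move=> x; apply: (cvg_unique _ (rho'E x x)) => //.
    apply: cvg_near_cst; near=> j; exact: (pd_refl (rhoP j)).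
  - move=> x y; apply: (cvg_unique _ (rho'E x y)) => //.
    rewrite (_ : (fun _ => _) = fun j => rho j y x); first exact: rho'E.
    by apply/funext => j; exact: (pd_sym (rhoP j)).
  - move=> y x z.
    rewrite -subr_le0.
    apply: (cvgr_to_le (cvgB (rho'E x z) (cvgD (rho'E x y) (rho'E y z)))).
    by near=> j; rewrite /= subr_le0 (pd_triangle (rhoP j)).
have rho'D x y : rho' x y <= D x y.
  by apply: (cvgr_to_le (rho'E x y)); near=> j; exact: rhoD.
exists rho'; split => // e e0.
(* If uniform closeness fails on a large set of indices, bad pairs of points
   chosen for these indices converge to a pair (x, y), and closeness at (x, y)
   propagates to the nearby bad pairs. *)
have [//|bad] := in_ultra_setVsetC
  [set j | forall x y, `|rho j x y - rho' x y| <= e] UU.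
exfalso.
have [j0 /= /existsNP[x0 _]] := filter_ex bad.
have bad' j : exists xy : T * T, (~ forall x y, `|rho j x y - rho' x y| <= e) ->
    e < `|rho j xy.1 xy.2 - rho' xy.1 xy.2|.
  have [h|/existsNP[x /existsNP[y /negP]]] :=
      pselect (forall x y, `|rho j x y - rho' x y| <= e).
    by exists (x0, x0) => /(_ h).
  by rewrite -ltNge => h; exists (x, y).
have /choice[xy xyP] := bad'.
have [x xU] := dist_compact_lim (fun j => (xy j).1) UU.
have [y yU] := dist_compact_lim (fun j => (xy j).2) UU.
have e5 : 0 < e / 5 by rewrite divr_gt0.
have : \forall j \near U, False.
  near=> j.
  have /xyP : ~ forall x y, `|rho j x y - rho' x y| <= e by near: j; exact: bad.
  apply/negP; rewrite -leNgt.
  have h1 : D (xy j).1 x < e / 5 by near: j; exact: xU.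
  have h2 : D (xy j).2 y < e / 5 by near: j; exact: yU.
  have h3 : `|rho j x y - rho' x y| < e / 5 by near: j; exact: rho'le.
  move: (xy j).1 (xy j).2 h1 h2 => p q h1 h2.
  have osc r : pseudo_dist r -> (forall x y, r x y <= D x y) ->
      `|r p q - r x y| <= e / 5 + e / 5.
    move=> rP rD.
    have t1 := pd_triangle rP x p q; have t2 := pd_triangle rP y x q.
    have t3 := pd_triangle rP p x y; have t4 := pd_triangle rP q p y.
    have s1 := pd_sym rP x p; have s2 := pd_sym rP y q.
    have d1 := rD p x; have d2 := rD q y.
    by rewrite ler_norml; apply/andP; split; lra.
  have := osc _ (rhoP j) (rhoD j); have := osc _ rho'P rho'D.
  move: h3; rewrite !ler_norml ltr_norml.
  by move=> /andP[? ?] /andP[? ?] /andP[? ?]; apply/andP; split; lra.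
by move=> /filter_ex[].
Unshelve. all: by end_near. Qed.

End short_images.

(** * Gromov-Hausdorff distance and common parametrizations *)

Section gromov_hausdorff_estimates.
Context {R : realType}.
Implicit Types A B : metricType R.

(** The supremum of an empty set of reals is zero, so [T] may be empty. *)
Lemma pseudo_dist_sup {S T : Type} (h : S -> T -> R) :
  (forall s s', exists M, forall x, `|h s x - h s' x| <= M) ->
  pseudo_dist (fun s s' => sup (range (fun x => `|h s x - h s' x|))).
Proof.
move=> hM.
have [x0|T0] := pselect (exists x : T, True); last first.
  have s0 s s' : sup (range (fun x : T => `|h s x - h s' x|)) = 0.
    have -> : range (fun x => `|h s x - h s' x|) = set0.
      by rewrite -subset0 => r [x _ _]; apply: T0; exists x.
    exact: sup0.
  by split=> *; rewrite !s0 ?addr0.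
have ne s s' : range (fun x => `|h s x - h s' x|) !=set0.
  by case: x0 => x _; exists `|h s x - h s' x|, x.
have ub s s' x : `|h s x - h s' x| <= sup (range (fun x => `|h s x - h s' x|)).
  apply: ub_le_sup; last by exists x.
  by have [M hMM] := hM s s'; exists M => _ [y _ <-].
split.
- move=> s; apply/eqP; rewrite eq_le; apply/andP; split.
    by apply: ge_sup => // _ [x _ <-]; rewrite subrr normr0.
  by case: x0 => x _; rewrite (le_trans _ (ub s s x)).
- move=> s s'; congr sup; apply/eq_imagel => x _; exact: distrC.
- move=> s' s s''; apply: ge_sup => // _ [x _ <-].
  by rewrite (le_trans (ler_distD (h s' x) _ _))// lerD.
Qed.

(** Two spaces with a common parametrization embed isometrically into
    functions on the parameter space with the supremum distance, by Kuratowski: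
    a point is sent to its distance function. Points with the same parameter are sent to functions
    at distance at most [r]. *)
Lemma gh_dist_le A B {T : Type} (pi : T -> A) (sg : T -> B) (r r' : R) :
  (forall a, exists x, pi x = a) -> (forall b, exists x, sg x = b) ->
  (forall x y, `|mdist (pi x) (pi y) - mdist (sg x) (sg y)| <= r) ->
  0 < r' -> r < r' -> (gh_dist A B <= r'%:E)%E.
Proof.
move=> /choice[s sK] /choice[t tK] pisg r'0 rr'.
(* The boolean selects which of the two spaces a copy of [T] parametrizes. *)
pose h (z : bool * T) (x : T) : R :=
  if z.1 then mdist (pi z.2) (pi x) else mdist (sg z.2) (sg x).
have mdistB (M : metricType R) (p q x : M) : `|mdist p x - mdist q x| <= mdist p q.
  have t1 := metric_triangle p q x; have t2 := metric_triangle q p x.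
  by rewrite ler_norml (metric_sym q p) in t2 *; apply/andP; split; lra.
have hM z z' : exists M, forall x, `|h z x - h z' x| <= M.
  exists (mdist (pi z.2) (pi z'.2) + mdist (sg z.2) (sg z'.2) + r) => x.
  have p0 := mdist_ge0 (pi z.2) (pi z'.2).
  have q0 := mdist_ge0 (sg z.2) (sg z'.2).
  have r0 : 0 <= r by rewrite (le_trans _ (pisg x x)).
  have dx := pisg z'.2 x.
  have dA := mdistB _ (pi z.2) (pi z'.2) (pi x).
  have dB := mdistB _ (sg z.2) (sg z'.2) (sg x).
  rewrite /h; case: z.1; case: z'.1; move: dx dA dB; rewrite !ler_norml;
    move=> /andP[? ?] /andP[? ?] /andP[? ?]; apply/andP; split; lra.
have dP := pseudo_dist_sup hM.
have [Z [ze [_ zeE]]] := metric_of_pseudo_dist dP.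
have subE (M : metricType R) (f : T -> M) (g : M -> T) : cancel g f ->
    forall p q, sup (range (fun x => `|mdist (f p) (f x) - mdist (f q) (f x)|)) =
      mdist (f p) (f q).
  move=> fK p q; apply/eqP; rewrite eq_le; apply/andP; split.
    apply: ge_sup; last by move=> _ [x _ <-]; exact: mdistB.
    by exists `|mdist (f p) (f p) - mdist (f q) (f p)|, p.
  apply: ub_le_sup.
    by exists (mdist (f p) (f q)) => _ [x _ <-]; exact: mdistB.
  by exists q => //; rewrite mdistxx subr0 ger0_norm ?mdist_ge0.
have near x : mdist (ze (true, x)) (ze (false, x)) < r'.
  rewrite (le_lt_trans _ rr')// zeE; apply: ge_sup.
    by exists `|h (true, x) x - h (false, x) x|, x.
  by move=> _ [y _ <-]; exact: pisg.
apply: (@le_trans _ _ (hausdorff_dist (range (fun a => ze (true, s a)))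
                                      (range (fun b => ze (false, t b))))).
  apply: ereal_inf_lbound.
  exists Z, (fun a => ze (true, s a)), (fun b => ze (false, t b)); split => //.
  - by move=> a a'; rewrite zeE /h/= (subE _ _ _ sK) !sK.
  - by move=> b b'; rewrite zeE /h/= (subE _ _ _ tK) !tK.
have zeA x : ze (true, x) = ze (true, s (pi x)).
  by apply: mdist_positivity; rewrite zeE /h/= (subE _ _ _ sK) sK mdistxx.
have zeB x : ze (false, x) = ze (false, t (sg x)).
  by apply: mdist_positivity; rewrite zeE /h/= (subE _ _ _ tK) tK mdistxx.
apply: ereal_inf_lbound; exists r' => //; split => //.
- move=> _ [a _ <-]; exists (ze (false, s a)).
    by exists (sg (s a)) => //; rewrite -zeB.
  by rewrite ballEmdist /= metric_sym.
- move=> _ [b _ <-]; exists (ze (true, t b)).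
    by exists (pi (t b)) => //; rewrite -zeA.
  by rewrite ballEmdist /=.
Qed.

(** Closeness of [A] to an image of [T] yields a map from [T] to [A] that is
    almost as contracting and almost onto; these are the maps whose ultralimits
    are taken below. *)
Lemma gh_dist_lt_approx A B {T : Type} (pi : T -> B) (e : R) :
  (forall b, exists x, pi x = b) -> (gh_dist A B < e%:E)%E ->
  exists th : T -> A,
    (forall x y, mdist (th x) (th y) <= mdist (pi x) (pi y) + e + e) /\
    (forall a, exists x, mdist (th x) a <= e + e).
Proof.
move=> pis /ereal_inf_lt[_ [Z [phi [psi [phiI psiI ->]]]]].
move=> /ereal_inf_lt[_ [r [r0 AB BA] <-]]; rewrite lte_fin => re.
have thE x : exists a, mdist (phi a) (psi (pi x)) < r.
  have [|_ [a _ <-]] := BA (psi (pi x)); first by exists (pi x).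
  by rewrite ballEmdist; exists a.
have {thE}/choice[th thE] := thE; exists th; split.
  move=> x y; rewrite -phiI -psiI.
  have t1 := metric_triangle (phi (th x)) (psi (pi x)) (phi (th y)).
  have t2 := metric_triangle (psi (pi x)) (psi (pi y)) (phi (th y)).
  have := thE x; have := thE y; rewrite (metric_sym (phi (th y))); lra.
move=> a; have [|_ [b _ <-]] := AB (phi a); first by exists a.
have [x <-] := pis b; rewrite ballEmdist/= => ax; exists x; rewrite -phiI.
have t1 := metric_triangle (phi (th x)) (psi (pi x)) (phi a).
have := thE x; lra.
Qed.

Lemma gh_dist_ge0 A B : (0 <= gh_dist A B)%E.
Proof.
apply: le_ereal_inf_tmp => _ [Z [phi [psi [_ _ ->]]]].
by apply: le_ereal_inf_tmp => _ [r [r0 _ _] <-]; rewrite lee_fin ltW.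
Qed.

End gromov_hausdorff_estimates.

Section short_images_gromov_hausdorff.
Context {R : realType} {T : Type} (D : T -> T -> R).
Hypothesis Dc : dist_compact D.

Definition short_quotient (A : compact_metric R) : Prop :=
  exists pi : T -> A, short_image D pi.

Lemma ultra_oo : exists2 U : set_system nat, UltraFilter U & \oo `<=` U.
Proof. by have [U [? ?]] := ultraFilterLemma eventually_filter; exists U. Qed.

(** If [A] is arbitrarily close to short images of [T], there are almost short
    and almost surjective maps from [T] to [A] with errors tending to zero. By
    compactness of [A] they have a pointwise ultralimit, which is short; by
    compactness of [T] almost preimages of a point accumulate at a preimage. *)
Lemma short_quotient_closed : gh_open (fun A => ~ short_quotient A).
Proof.
move=> A; apply: contra_notP => nopen.
have {}nopen n : exists th : T -> A,
    (forall x y, mdist (th x) (th y) <= D x y + n.+1%:R^-1 + n.+1%:R^-1) /\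
    (forall a, exists x, mdist (th x) a <= n.+1%:R^-1 + n.+1%:R^-1).
  apply: contrapT => nth; apply: nopen; exists n.+1%:R^-1 => // B AB.
  move=> [pi [pis piD]]; apply: nth.
  have [th [thD ths]] := gh_dist_lt_approx pis AB.
  exists th; split => // x y.
  by rewrite (le_trans (thD _ _))// !lerD2r.
have /choice[th thP] := nopen.
have thD n := (thP n).1; have ths n := (thP n).2.
have [U UU oU] := ultra_oo.
have small (e : R) : 0 < e -> \forall n \near U, n.+1%:R^-1 < e.
  by move=> e0; apply: oU; exact: near_infty_natSinv_lt (PosNum e0).
have lim x : exists a : A, (fun n => th n x) @ U --> a.
  have [//|a _ ha] := @ultra_cvg_compact _ A setT (fun n => th n x) _ UU
    (@cm_compact _ A).
  by exists a.
have /choice[pi piE] := lim.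
exists pi; split.
  move=> a; have /choice[x xE] := fun n => ths n a.
  have [y yU] := dist_compact_lim Dc x UU.
  exists y; apply: mdist_positivity; apply/eqP; rewrite eq_le mdist_ge0 andbT.
  apply/ler_addgt0Pl => e e0; rewrite addr0.
  have e6 : 0 < e / 6 by rewrite divr_gt0.
  have : \forall n \near U, mdist (pi y) a <= e.
    near=> n.
    have h1 : mdist (th n y) (pi y) < e / 6.
      by near: n; exact: (cvg_mdist (piE y) e6).
    have h2 : D (x n) y < e / 6 by near: n; exact: yU.
    have h3 : n.+1%:R^-1 < e / 6 by near: n; exact: small.
    have h4 := thD n (x n) y; have h5 := xE n.
    have t1 := metric_triangle (pi y) (th n y) a.
    have t2 := metric_triangle (th n y) (th n (x n)) a.
    move: h1 h4; rewrite (metric_sym (th n y) (pi y)).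
    rewrite (metric_sym (th n (x n)) (th n y)).
    by move: n.+1%:R^-1 h3 h5 => i; lra.
  by move=> /filter_ex[].
move=> x y; apply/ler_addgt0Pl => e e0.
have e4 : 0 < e / 4 by rewrite divr_gt0.
have : \forall n \near U, mdist (pi x) (pi y) <= e + D x y.
  near=> n.
  have h1 : mdist (th n x) (pi x) < e / 4.
    by near: n; exact: (cvg_mdist (piE x) e4).
  have h2 : mdist (th n y) (pi y) < e / 4.
    by near: n; exact: (cvg_mdist (piE y) e4).
  have h3 : n.+1%:R^-1 < e / 4 by near: n; exact: small.
  have h4 := thD n x y.
  have t1 := metric_triangle (pi x) (th n x) (pi y).
  have t2 := metric_triangle (th n x) (th n y) (pi y).
  move: h1; rewrite (metric_sym (th n x) (pi x)).
  by move: n.+1%:R^-1 h3 h4 => i; lra.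
by move=> /filter_ex[].
Unshelve. all: by end_near. Qed.

Definition pullback_dist (A : metricType R) (pi : T -> A) (x y : T) : R :=
  mdist (pi x) (pi y).

Lemma pullback_pseudo_dist (A : metricType R) (pi : T -> A) :
  pseudo_dist (pullback_dist pi).
Proof.
split=> *; first exact: mdistxx.
- exact: metric_sym.
- exact: metric_triangle.
Qed.

Lemma short_quotient_of_dist (rho : T -> T -> R) :
  pseudo_dist rho -> (forall x y, rho x y <= D x y) ->
  exists (A : compact_metric R) (pi : T -> A),
    short_image D pi /\ forall x y, mdist (pi x) (pi y) = rho x y.
Proof.
move=> rhoP rhoD; have [Q [pi [pis piE]]] := metric_of_pseudo_dist rhoP.
have piD : short_image D pi by split=> // x y; rewrite piE.
by exists (CompactMetric (short_image_compact Dc piD)), pi.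
Qed.

Lemma short_quotient_ultralimit {J : Type} (U : set_system J)
    (A : J -> compact_metric R) (pi : forall j, T -> A j) :
  UltraFilter U -> (forall j, short_image D (pi j)) ->
  exists2 Z : compact_metric R, short_quotient Z &
    forall e, 0 < e -> \forall j \near U, (gh_dist (A j) Z < e%:E)%E.
Proof.
move=> UU piD.
have [rho [rhoP rhoD rhoE]] := pseudo_dist_ultralimit Dc UU
  (fun j => pullback_pseudo_dist (pi j)) (fun j => (piD j).2).
have [Z [p [pD pE]]] := short_quotient_of_dist rhoP rhoD.
exists Z; first by exists p.
move=> e e0; have e3 : 0 < e / 3 by rewrite divr_gt0.
apply: filterS (rhoE _ e3) => j jE.
have close x y : `|mdist (p x) (p y) - mdist (pi j x) (pi j y)| <= e / 3.
  by rewrite distrC pE; exact: jE.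
apply: (@le_lt_trans _ _ (e / 2)%:E); last by rewrite lte_fin; lra.
by apply: (gh_dist_le (piD j).1 pD.1 (r := e / 3)) => [x y||]; rewrite 1?distrC//; lra.
Qed.

(** Suppose that no finite subfamily covers. The spaces missed by the finite
    subfamilies generate a filter on the set of pseudo-distances dominated by
    [D]; the limit of a finer ultrafilter gives a short image of [T], which lies
    in some member [V] of the cover together with all short images close to it,
    although spaces outside [V] form a large set. *)
Lemma short_quotient_gh_compact : gh_compact short_quotient.
Proof.
move=> C Copen Ccov; apply: contrapT => nfin.
pose J := {rho : T -> T -> R | pseudo_dist rho /\ forall x y, rho x y <= D x y}.
(* The filter lives on pseudo-distances rather than on spaces, since the latter
   do not form a set. *)
pose F : set_system J := fun S => exists n (V : 'I_n -> compact_metric R -> Prop),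
  (forall i, C (V i)) /\
  (forall (A : compact_metric R) (pi : T -> A), short_image D pi ->
    (forall i, ~ V i A) -> forall j : J, sval j = pullback_dist pi -> S j).
have FF : ProperFilter F.
  split; last split.
  - move=> [n [V [CV VF]]]; apply: nfin; exists n, V; split => // A [pi piD].
    apply: contrapT => /forallNP nVA.
    exact: (VF A pi piD nVA (exist _ (pullback_dist pi)
      (conj (pullback_pseudo_dist pi) piD.2))).
  - exists 0%N, (fun _ _ => True); split; first by case.
    by [].
  - move=> S S' [n [V [CV VS]]] [n' [V' [CV' VS']]].
    exists (n + n')%N, (fun i => match fintype.split i with
      inl i => V i | inr i => V' i end).
    split; first by move=> i; case: splitP.
    move=> A pi piD nV j jE; split.
      apply: (VS A pi) => // i Vi; apply: (nV (lshift n' i)).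
      by rewrite (unsplitK (inl _ i)).
    apply: (VS' A pi) => // i Vi; apply: (nV (rshift n i)).
    by rewrite (unsplitK (inr _ i)).
  - move=> S S' SS' [n [V [CV VS]]]; exists n, V; split => // A pi piD nV j jE.
    by apply: SS'; exact: VS jE.
have [U [UU FU]] := ultraFilterLemma FF.
have [rho [rhoP rhoD rhoE]] := pseudo_dist_ultralimit Dc UU
  (fun j : J => (svalP j).1) (fun j : J => (svalP j).2).
have [Z [p [pD pE]]] := short_quotient_of_dist rhoP rhoD.
have [V CV VZ] : exists2 V, C V & V Z by apply: Ccov; exists p.
have [e e0 eV] := Copen V CV Z VZ.
have Uclose := rhoE (e / 3) (divr_gt0 e0 (ltr0Sn _ 2)).
have UV : U [set j | exists (A : compact_metric R) (pi : T -> A),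
    [/\ short_image D pi, ~ V A & sval j = pullback_dist pi]].
  apply: FU; exists 1%N, (fun=> V); split => // A pi piD nV j jE.
  by exists A, pi; split => //; exact: (nV ord0).
have [j [/= jclose [A [pi [piD nVA jE]]]]] := filter_ex (filterI Uclose UV).
apply/nVA/eV; apply: (@le_lt_trans _ _ (e / 2)%:E); last by rewrite lte_fin; lra.
apply: (gh_dist_le pD.1 piD.1 (r := e / 3)); [|lra|lra] => x y.
by rewrite pE distrC; have := jclose x y; rewrite jE.
Qed.

(** A set of indices in an ultrafilter finer than the Frechet filter is
    unbounded, so convergence along the ultrafilter yields a subsequence. *)
Lemma short_quotient_subsequence (Y : nat -> compact_metric R) :
  (forall n, short_quotient (Y n)) ->
  exists (k : nat -> nat) (Z : compact_metric R),
    {homo k : m n / (m < n)%N} /\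
    (fun n => gh_dist (Y (k n)) Z) @ \oo --> 0%E.
Proof.
move=> YK; have [U UU oU] := ultra_oo.
have [Z _ Zlim] := short_quotient_ultralimit UU (fun n => svalP (cid (YK n))).
have next n m : exists N, (m < N)%N /\ (gh_dist (Y N) Z < (n.+1%:R^-1)%:E)%E.
  have h : 0 < n.+1%:R^-1 :> R by rewrite invr_gt0.
  have Um : U [set N | (m < N)%N] by apply: oU; exact: nbhs_infty_gt.
  by have [N [? ?]] := filter_ex (filterI Um (Zlim _ h)); exists N.
have nextn n : exists f : nat -> nat, forall m,
    (m < f m)%N /\ (gh_dist (Y (f m)) Z < (n.+1%:R^-1)%:E)%E.
  by have /choice[f fE] := next n; exists f.
have /choice[g gE] := nextn.
pose k := fix k n := if n is n'.+1 then g n (k n') else g 0%N 0%N.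
have kE n : (gh_dist (Y (k n)) Z < (n.+1%:R^-1)%:E)%E.
  by case: n => [|n]; exact: (gE _ _).2.
exists k, Z; split.
  by apply: homo_ltn => [? ? ?|n]; [exact: ltn_trans|exact: (gE n.+1 (k n)).1].
apply: (@squeeze_cvge _ _ _ _ (cst 0%E) _ (fun n => (n.+1%:R^-1)%:E)).
- by near=> n; rewrite gh_dist_ge0/= ltW.
- exact: cvg_cst.
- apply: cvg_EFin; first by near=> n.
  exact: cvg_harmonic.
Unshelve. all: by end_near. Qed.

Lemma gh_closureC_open (S : compact_metric R -> Prop) :
  gh_open (fun A => ~ gh_closure S A).
Proof.
move=> A; apply: contra_notP => nopen V Vopen VA; apply: contrapT => nS.
apply: nopen; have [e e0 eV] := Vopen A VA; exists e => // B AB clB.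
have [E SE VE] := clB V Vopen (eV B AB).
by apply: nS; exists E.
Qed.

(** A closed subclass of a compact class is compact: complete a cover of the
    closure by the complement of the closure. *)
Lemma short_quotient_gh_precompact (S : compact_metric R -> Prop) :
  (forall A, S A -> short_quotient A) -> gh_precompact S.
Proof.
move=> SK C Copen Ccov.
have clK A : gh_closure S A -> short_quotient A.
  move=> clA; apply: contrapT => nKA.
  by have [B /SK KB] := clA _ short_quotient_closed nKA.
pose C' V := C V \/ V = (fun A => ~ gh_closure S A).
have [||n [V [CV VK]]] := short_quotient_gh_compact (C := C').
- by move=> V [/Copen//|->]; exact: gh_closureC_open.
- move=> A _; have [/Ccov[V CV VA]|nclA] := pselect (gh_closure S A).
    by exists V => //; left.
  by exists (fun A => ~ gh_closure S A) => //; right.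
have [[A0 clA0]|nclS] := pselect (exists A, gh_closure S A); last first.
  by exists 0%N, (fun _ _ => True); split=> [[]//|A clA]; case: nclS; exists A.
have [V0 CV0 _] := Ccov _ clA0.
exists n, (fun i => if pselect (C (V i)) then V i else V0); split.
  by move=> i; case: pselect.
move=> A clA; have [i ViA] := VK A (clK A clA).
exists i; case: pselect => // nCVi; exfalso.
by case: (CV i) => // ViE; move: (V i) ViE ViA => _ -> /(_ clA).
Qed.

End short_images_gromov_hausdorff.

(** * Compact length spaces are geodesic *)

Section geodesics.
Context {R : realType} {X : metricType R}.

Lemma mdist_continuous (x : X) : continuous (mdist x : X -> R).
Proof.
move=> y; apply/cvgrPdist_lt => e e0.
near=> z.
have yz : mdist z y < e by near: z; exact: (cvg_mdist cvg_id e0).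
have t1 := metric_triangle x y z; have t2 := metric_triangle x z y.
by rewrite (metric_sym y z) in t1; rewrite ltr_norml; apply/andP; split; lra.
Unshelve. all: by end_near. Qed.

(** The times may coincide, in which case they are not all points of the same
    strictly increasing partition. *)
Lemma curve_length_ge3 (u v s t : R) (c : R -> X) :
  u <= s -> s <= t -> t <= v ->
  ((mdist (c u) (c s) + mdist (c s) (c t) + mdist (c t) (c v))%:E
    <= curve_length u v c)%E.
Proof.
move=> us st tv.
have ub r : itv_partition u v r ->
    ((curve_variation u v c r)%:E <= curve_length u v c)%E.
  by move=> ruv; apply: ereal_sup_ubound; exists r.
have step (a b : R) : a <= b -> exists r,
    [/\ itv_partition a b r, (size r <= 1)%N
      & forall r' v', mdist (c a) (c b) +
          curve_variation b v' c r' = curve_variation a v' c (r ++ r')].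
  rewrite le_eqVlt => /predU1P[<-|ab].
    by exists [::]; split => // r' v'; rewrite mdistxx add0r.
  exists [:: b]; split => //; first exact: itv_partition1.
  by move=> r' v'; rewrite /curve_variation/= big_nat_recl.
have [r1 [p1 _ e1]] := step _ _ us.
have [r2 [p2 _ e2]] := step _ _ st.
have [r3 [p3 _ e3]] := step _ _ tv.
have e0 : curve_variation v v c [::] = 0 by rewrite /curve_variation big_nil.
have := ub _ (itv_partition_cat p1 (itv_partition_cat p2 p3)).
by rewrite -e1 -e2 -[r3]cats0 -e3 e0 addr0 addrA.
Qed.

(** On a curve from [x] to [y] of length less than [mdist x y + e], let [g s] be
    a point at distance [s] from [x].
    The times at which the curve passes there need not increase with [s], but in
    either order the length bound controls the distance of [g s] and [g t]. *)
Lemma almost_geodesic (lenX : length_space X) (x y : X) (e : R) : 0 < e ->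
  exists g : R -> X, forall s, 0 <= s <= mdist x y ->
    [/\ mdist x (g s) = s, mdist (g s) y <= mdist x y - s + e
      & forall t, 0 <= t <= mdist x y ->
          `|s - t| <= mdist (g s) (g t) <= `|s - t| + e].
Proof.
move=> e0; have : ((mdist x y)%:E < (mdist x y + e)%:E)%E by rewrite lte_fin ltrDl.
rewrite {1}lenX; set L := mdist x y.
move=> /ereal_inf_lt[_ [u [v [c [uv cc cu cv ->]]]] cL].
have tau s : exists t, 0 <= s <= L -> [/\ u <= t, t <= v & mdist x (c t) = s].
  have [|] := boolP (0 <= s <= L); last by exists u.
  move=> /andP[s0 sL].
  have [||t tuv ts] := @IVT R (fun t => mdist x (c t)) u v s (ltW uv).
  - have : continuous ((mdist x : X -> R) \o (c : subspace `[u, v]%classic -> X)).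
      by move=> z; apply: continuous_comp; [exact: cc|exact: mdist_continuous].
    by [].
  - by rewrite cu cv mdistxx -/L minEle maxEle (le_trans s0 sL) s0.
  - by exists t => _; move: tuv; rewrite in_itv/= => /andP[].
have /choice[T TE] := tau.
exists (c \o T) => s sL; have [us sv xs] := TE s sL.
have len r r' : u <= r -> r <= r' -> r' <= v ->
    mdist x (c r) + mdist (c r) (c r') + mdist (c r') y <= L + e.
  move=> ur rr' rv; rewrite -lee_fin; apply: ltW; apply: le_lt_trans cL.
  by rewrite -cu -cv; exact: curve_length_ge3.
have l1 := len _ _ us (lexx _) sv.
split=> //=; first by move: l1; rewrite xs mdistxx; lra.
move=> t tL; have [ut tv xt] := TE t tL.
have t1 := metric_triangle x (c (T s)) (c (T t)).
have t2 := metric_triangle x (c (T t)) (c (T s)).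
have t3 := metric_triangle x (c (T s)) y.
have t4 := metric_triangle x (c (T t)) y.
rewrite -/L in t3 t4; rewrite (metric_sym (c (T t)) (c (T s))) in t2.
apply/andP; split; first by rewrite ler_norml; apply/andP; split; lra.
have b1 : s - t <= `|s - t| by exact: ler_norm.
have b2 : t - s <= `|s - t| by rewrite distrC; exact: ler_norm.
have [st|/ltW ts] := leP (T s) (T t).
  by have := len _ _ us st tv; lra.
by have := len _ _ ut ts sv; rewrite (metric_sym (c (T t)) (c (T s))); lra.
Qed.

(** An ultralimit of almost geodesics with errors tending to zero. *)
Lemma geodesic (cptX : compact [set: X]) (lenX : length_space X) (x y : X) :
  exists g : R -> X, [/\ g 0 = x, g (mdist x y) = y
    & forall s t, 0 <= s <= mdist x y -> 0 <= t <= mdist x y ->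
        mdist (g s) (g t) = `|s - t|].
Proof.
have n0 n : 0 < n.+1%:R^-1 :> R by rewrite invr_gt0.
have /choice[g gE] := fun n => almost_geodesic lenX x y (n0 n).
have [U UU oU] := ultra_oo.
have lim s : exists p : X, (fun n => g n s) @ U --> p.
  by have [//|p _ gp] := @ultra_cvg_compact _ X setT (fun n => g n s) _ UU cptX; exists p.
have /choice[h hE] := lim; exists h.
have small (e : R) : 0 < e -> \forall n \near U, n.+1%:R^-1 < e.
  by move=> e0; apply: oU; exact: near_infty_natSinv_lt (PosNum e0).
have L0 := mdist_ge0 x y; set L := mdist x y in gE L0 *.
have hlim (e : R) s t : 0 < e -> \forall n \near U,
    [/\ mdist (g n s) (h s) < e, mdist (g n t) (h t) < e & n.+1%:R^-1 < e].
  move=> e0; near=> n; split; near: n; last exact: small.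
    exact: (cvg_mdist (hE s) e0).
  exact: (cvg_mdist (hE t) e0).
have eq0 (a b : X) : (forall e, 0 < e -> mdist a b <= e) -> a = b.
  move=> ab; apply: mdist_positivity; apply/eqP; rewrite eq_le mdist_ge0 andbT.
  by apply/ler_addgt0Pl => e e0; rewrite addr0 ab.
split.
- apply: eq0 => e e0; have [n [h1 _ _]] := filter_ex (hlim _ 0 0 e0).
  have [|h2 _ _] := gE n 0; first by rewrite lexx.
  have t1 := metric_triangle (h 0) (g n 0) x.
  by rewrite (metric_sym (g n 0) x) h2 (metric_sym _ (g n 0)) in t1; lra.
- have e2 e : 0 < e -> 0 < e / 2 :> R by move=> e0; rewrite divr_gt0.
  apply: eq0 => e /e2 e0; have [n [h1 _ h3]] := filter_ex (hlim _ L L e0).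
  have [|_ h2 _] := gE n L; first by rewrite lexx L0.
  have t1 := metric_triangle (h L) (g n L) y.
  rewrite (metric_sym _ (g n L)) in t1; move: n.+1%:R^-1 h3 h2 => i; lra.
- move=> s t sL tL; apply/eqP; rewrite eq_le; apply/andP.
  split; apply/ler_addgt0Pl => e e0.
    have e3 : 0 < e / 3 by rewrite divr_gt0.
    have [n [h1 h2 h3]] := filter_ex (hlim _ s t e3).
    have [_ _ /(_ t tL) /andP[_ h4]] := gE n s sL.
    have t1 := metric_triangle (h s) (g n s) (h t).
    have t2 := metric_triangle (g n s) (g n t) (h t).
    rewrite (metric_sym (h s) (g n s)) in t1.
    by move: n.+1%:R^-1 h3 h4 => i; lra.
  have e2 : 0 < e / 2 by rewrite divr_gt0.
  have [n [h1 h2 h3]] := filter_ex (hlim _ s t e2).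
  have [_ _ /(_ t tL) /andP[h4 _]] := gE n s sL.
  have t1 := metric_triangle (g n s) (h s) (g n t).
  have t2 := metric_triangle (h s) (h t) (g n t).
  rewrite (metric_sym (h t) (g n t)) in t2; lra.
Unshelve. all: by end_near. Qed.

End geodesics.

(** * Derivatives and null sets on the line *)

Section real_line.
Context {R : realType}.

Lemma dnbhs0P (P : R -> Prop) :
  (\forall h \near 0^', P h) <->
  exists2 d : R, 0 < d & forall h, h != 0 -> `|h| < d -> P h.
Proof.
rewrite /dnbhs near_withinE; split.
  move=> /nbhs_ballP[d /= d0 dP]; exists d => // h h0 hd.
  by apply: dP => //; rewrite /ball/= sub0r normrN.
move=> [d d0 dP]; apply/nbhs_ballP; exists d => //= h.
by rewrite /ball/= sub0r normrN => hd h0; exact: dP.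
Qed.

(** Without quotients, for use in estimates and for changes of curves. *)
Lemma is_metric_derivativeP {X : metricType R} (c : R -> X) (s w : R) :
  is_metric_derivative c s w <->
  forall e, 0 < e -> exists2 d, 0 < d & forall h, h != 0 -> `|h| < d ->
    `|mdist (c (s + h)) (c s) - w * `|h| | <= e * `|h|.
Proof.
have quot (h : R) : h != 0 -> mdist (c (s + h)) (c s) - w * `|h| =
    (mdist (c (s + h)) (c s) / `|h| - w) * `|h|.
  by move=> h0; rewrite mulrBl divfK// normr_eq0.
split=> [/cvgrPdistC_le cs e e0|cs].
  have /dnbhs0P[d d0 dP] := cs e e0.
  exists d => // h h0 hd; rewrite quot// normrM normr_id ler_wpM2r//.
  exact: dP.
apply/cvgrPdistC_le => e e0; apply/dnbhs0P; have [d d0 dP] := cs e e0.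
exists d => // h h0 hd; have := dP h h0 hd.
by rewrite quot// normrM normr_id ler_pM2r// normr_gt0.
Qed.

Lemma is_derive_approx (f : R -> R) (s a : R) : is_derive s 1 f a ->
  forall e, 0 < e -> exists2 d, 0 < d & forall h, h != 0 -> `|h| < d ->
    `|f (s + h) - f s - a * h| <= e * `|h|.
Proof.
move=> [df fa] e e0.
have /cvgrPdistC_le/(_ _ e0)/dnbhs0P[d d0 dP] :
    (fun h => h^-1 *: ((f \o shift s) (h *: 1) - f s)) @ 0^' --> a.
  by rewrite -fa; exact: df.
exists d => // h h0 hd; have := dP h h0 hd.
rewrite /= [_ *: 1]mulr1 [h + s]addrC => b.
rewrite -(@ler_pM2l _ `|h^-1|) ?normr_gt0 ?invr_eq0// -normrM mulrBr mulrCA.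
rewrite mulVf// mulr1 mulrCA normrV ?unitfE// mulVf ?normr_eq0// mulr1.
exact: b.
Qed.

Lemma ae_mono (P Q : R -> Prop) : (forall s, P s -> Q s) ->
  {ae lebesgue_measure, forall s : R, P s} ->
  {ae lebesgue_measure, forall s : R, Q s}.
Proof.
move=> PQ [A [mA A0 PA]]; exists A; split => // s nQ.
by apply: PA => /PQ.
Qed.

(** The image of Lebesgue measure under a reflection agrees with Lebesgue
    measure on half-open intervals, hence everywhere. *)
Lemma ae_reflect (c : R) (P : R -> Prop) :
  {ae lebesgue_measure, forall s : R, P s} ->
  {ae lebesgue_measure, forall s : R, P (c - s)}.
Proof.
move=> [A [mA A0 PA]].
have mf : measurable_fun [set: measurableTypeR R]
    ((fun s => c - s) : measurableTypeR R -> measurableTypeR R).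
  by apply: measurable_funB => //; exact: measurable_cst.
exists ((fun s => c - s) @^-1` A); split => /=; last by move=> s; exact: PA.
  by rewrite -[X in measurable X]setTI; exact: mf.
rewrite -[RHS]A0 (lebesgue_measure_unique
  (mu := measure_function_pushforward__canonical__measure_function_Measure
     (@lebesgue_measure R) mf) _ mA)//.
move=> _ [[a b] _ <-]; rewrite /= /pushforward/=.
have -> : (fun s => c - s) @^-1` `]a, b] = `[c - b, c - a[%classic.
  apply/seteqP; split => s /=; rewrite !in_itv/=.
    by move=> /andP[? ?]; apply/andP; split; lra.
  by move=> /andP[? ?]; apply/andP; split; lra.
rewrite !lebesgue_measure_itv/= !lte_fin ltrD2l ltrN2.
by case: ifP => // _; rewrite -!EFinB; congr EFin; lra.
Qed.

End real_line.

(** * Causal curves: locality and time reversal *)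

Section abs_continuous_curves.
Context {R : realType} {X : metricType R}.
Implicit Types (u v k : R) (c : R -> X).

Lemma abs_continuous_congr u v c c' : {in `[u, v], c =1 c'} ->
  abs_continuous u v c -> abs_continuous u v c'.
Proof.
move=> cc' cac e e0; have [d d0 dP] := cac e e0; exists d => // n x y xy tI small.
have := dP n x y xy tI small; congr (_ < _); apply: eq_bigr => i _.
by have [? ? ?] := xy i; rewrite !cc'// in_itv/=; apply/andP; split; lra.
Qed.

Lemma abs_continuous_reflect u v k c : abs_continuous u v c ->
  abs_continuous (k - v) (k - u) (fun s => c (k - s)).
Proof.
move=> cac e e0; have [d d0 dP] := cac e e0; exists d => // n x y xy tI small.
have := dP n (fun i => k - y i) (fun i => k - x i).
have eqS : \sum_(i < n) (k - x i - (k - y i)) = \sum_(i < n) (y i - x i).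
  by apply: eq_bigr => i _; lra.
rewrite eqS => /(_ _ _ small) h.
under eq_bigr do rewrite metric_sym.
apply: h => [i|i j _ _ [s /= [si sj]]].
  by have [? ? ?] := xy i; split; lra.
apply: tI => //; exists (k - s) => /=; move: si sj; rewrite !in_itv/=.
by move=> /andP[? ?] /andP[? ?]; split; apply/andP; split; lra.
Qed.

Lemma abs_continuous_lipschitz u v c (K : R) :
  (forall s t, u <= s -> s <= t -> t <= v -> mdist (c s) (c t) <= K * (t - s)) ->
  abs_continuous u v c.
Proof.
move=> cK e e0; have K1 : 0 < `|K| + 1 by rewrite ltr_pwDr.
exists (e / (`|K| + 1)); first by rewrite divr_gt0.
move=> n x y xy _; rewrite ltr_pdivlMr// mulrC mulr_sumr => small.
apply: le_lt_trans small; apply: ler_sum => i _.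
have [ux xy' yv] := xy i; apply: le_trans (cK _ _ ux xy' yv) _.
by rewrite ler_wpM2r ?subr_ge0// (le_trans (ler_norm K))// lerDl.
Qed.

Lemma is_metric_derivative_congr u v c c' s w : {in `[u, v], c =1 c'} ->
  s \in `]u, v[ -> is_metric_derivative c s w -> is_metric_derivative c' s w.
Proof.
rewrite in_itv/= => cc' /andP[us sv] /is_metric_derivativeP cs.
apply/is_metric_derivativeP => e e0; have [d d0 dP] := cs e e0.
exists (Num.min d (Num.min (s - u) (v - s))); first by rewrite !lt_min d0 !subr_gt0 us sv.
move=> h h0; rewrite !lt_min => /and3P[hd hu hv].
rewrite -!cc'; first exact: dP.
  by rewrite in_itv/=; apply/andP; split; lra.
by move: hu hv; rewrite !ltr_norml in_itv/= => /andP[? ?] /andP[? ?]; apply/andP; split; lra.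
Qed.

Lemma is_metric_derivative_reflect k c s w : is_metric_derivative c (k - s) w ->
  is_metric_derivative (fun t => c (k - t)) s w.
Proof.
move=> /is_metric_derivativeP cs; apply/is_metric_derivativeP => e e0.
have [d d0 dP] := cs e e0; exists d => // h h0 hd.
have := dP (- h); rewrite oppr_eq0 normrN => /(_ h0 hd).
by rewrite (_ : k - (s + h) = k - s - h)//; lra.
Qed.

Lemma is_derive_reflect k (al : R -> R) s a : is_derive (k - s) 1 al a ->
  is_derive s 1 (fun t => al (k - t)) (- a).
Proof.
move=> ald; have kd : is_derive s 1 (fun t : R => k - t) (- 1).
  have := is_deriveB (is_derive_cst k s 1) (is_derive_id s (1 : R)).
  by rewrite sub0r.
by have := @is_derive1_comp R al (fun t => k - t) s a (- 1) ald kd; rewrite mulrN1.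
Qed.

Lemma is_derive_congr u v (al al' : R -> R) s a : {in `[u, v], al =1 al'} ->
  s \in `]u, v[ -> is_derive s 1 al a -> is_derive s 1 al' a.
Proof.
move=> aa' suv; apply: near_eq_is_derive.
have := near_in_itvoo suv; apply: filterS => t tuv.
by apply: aa'; exact: subset_itv_oo_cc.
Qed.

End abs_continuous_curves.

Section causal_pieces.
Context {R : realType} {X : metricType R}.
Implicit Types (f al : R -> R) (be : R -> X) (u v k : R).

Definition causal_piece f u v al be : Prop :=
  [\/ constant_curve u v al be, future_causal f u v al be
    | past_causal f u v al be].

Lemma causal_congr f u v al al' be be' : {in `[u, v], al =1 al'} ->
  {in `[u, v], be =1 be'} -> causal f u v al be -> causal f u v al' be'.
Proof.
move=> aa' bb' [alac beac mono ae]; split.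
- exact: (@abs_continuous_congr R R^o u v al al').
- exact: abs_continuous_congr bb' beac.
- case: mono => mono; [left|right] => s t sI tI st; rewrite -!aa'//; exact: mono.
- apply: ae_mono ae => s sP suv; have [a' [w [da mw ineq]]] := sP suv.
  exists a', w; rewrite -aa' ?subset_itv_oo_cc//; split => //.
  + exact: is_derive_congr aa' suv da.
  + exact: is_metric_derivative_congr bb' suv mw.
Qed.

Lemma causal_piece_congr f u v al al' be be' : u <= v ->
  {in `[u, v], al =1 al'} -> {in `[u, v], be =1 be'} ->
  causal_piece f u v al be -> causal_piece f u v al' be'.
Proof.
move=> uv aa' bb' [cst|[c d]|[c d]].
- apply: Or31 => s sI; rewrite -!aa' -?bb' ?bound_itvE//; exact: cst.
- apply: Or32; split; first exact: causal_congr aa' bb' c.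
  apply: ae_mono d => s sP suv; have [a' da a'0] := sP suv.
  by exists a' => //; exact: is_derive_congr aa' suv da.
- apply: Or33; split; first exact: causal_congr aa' bb' c.
  apply: ae_mono d => s sP suv; have [a' da a'0] := sP suv.
  by exists a' => //; exact: is_derive_congr aa' suv da.
Qed.

Lemma itv_reflect (b1 b2 : bool) u v k s :
  s \in Interval (BSide b1 (k - v)) (BSide b2 (k - u)) ->
  k - s \in Interval (BSide (~~ b2) u) (BSide (~~ b1) v).
Proof.
by rewrite !itv_boundlr/=; case: b1 b2 => -[]; rewrite /= ?bnd_simp;
  move=> /andP[? ?]; apply/andP; split; lra.
Qed.

(** The reflection [s |-> k - s] reverses a curve; two reflections translate it,
    so translations of curves need no separate treatment. *)
Lemma causal_reflect f u v k al be : causal f u v al be ->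
  causal f (k - v) (k - u) (fun s => al (k - s)) (fun s => be (k - s)).
Proof.
move=> [alac beac mono ae]; split.
- exact: (@abs_continuous_reflect R R^o).
- exact: abs_continuous_reflect.
- by case: mono => mono; [right|left] => s t sI tI st; apply: mono;
    [exact: itv_reflect sI|exact: itv_reflect tI|lra
    |exact: itv_reflect sI|exact: itv_reflect tI|lra].
- apply: ae_mono (ae_reflect k ae) => s sP suv.
  have [a' [w [da mw ineq]]] := sP (itv_reflect suv).
  exists (- a'), w; rewrite sqrrN; split => //; first exact: is_derive_reflect.
  exact: is_metric_derivative_reflect.
Qed.

Lemma causal_piece_reflect f u v k al be : u <= v -> causal_piece f u v al be ->
  causal_piece f (k - v) (k - u) (fun s => al (k - s)) (fun s => be (k - s)).
Proof.
move=> uv [cst|[c d]|[c d]].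
- apply: Or31 => s sI.
  have -> : k - (k - v) = v by lra.
  have [-> ->] := cst _ (itv_reflect sI).
  by have [|-> ->] := cst v; rewrite ?bound_itvE.
- apply: Or33; split; first exact: causal_reflect.
  apply: ae_mono (ae_reflect k d) => s sP suv.
  have [a' da a'0] := sP (itv_reflect suv).
  by exists (- a'); [exact: is_derive_reflect|rewrite oppr_lt0].
- apply: Or32; split; first exact: causal_reflect.
  apply: ae_mono (ae_reflect k d) => s sP suv.
  have [a' da a'0] := sP (itv_reflect suv).
  by exists (- a'); [exact: is_derive_reflect|rewrite oppr_gt0].
Qed.

End causal_pieces.

(** * The null distance as an infimum over chains of points *)

Section null_chains.
Context {R : realType} {X : metricType R} (f : R -> R) (a b : R).
Implicit Types (al : R -> R) (be : R -> X) (p q r : R * X) (u v k l : R).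

(** Points of the cone are pairs in [R * X]; that the time stays in [a, b] is a
    condition on the curve. *)
Definition hop_on u v p q : Prop := exists al be,
  [/\ {in `[u, v], forall t, al t \in `[a, b]}, causal_piece f u v al be
    & [/\ al u = p.1, be u = p.2, al v = q.1 & be v = q.2]].

Definition hop p q : Prop := exists u v, u < v /\ hop_on u v p q.

(** The null length of a piecewise causal curve depends only on the endpoints of
    its pieces, so a curve can be replaced by the list of these endpoints. *)
Inductive null_chain : R * X -> R * X -> R -> Prop :=
| null_chain_refl p : null_chain p p 0
| null_chain_hop p q r l : hop p q -> null_chain q r l ->
    null_chain p r (`|q.1 - p.1| + l).

Lemma hop_on_reflect u v k p q : u <= v -> hop_on u v p q ->
  hop_on (k - v) (k - u) q p.
Proof.
move=> uv [al [be [alI pc [au bu av bv]]]].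
exists (fun s => al (k - s)), (fun s => be (k - s)); split.
- by move=> s sI; apply: alI; exact: itv_reflect sI.
- exact: causal_piece_reflect.
- by rewrite !subKr.
Qed.

Lemma hop_sym p q : hop p q -> hop q p.
Proof.
move=> [u [v [uv /(hop_on_reflect 0 (ltW uv)) h]]].
by exists (0 - v), (0 - u); split => //; lra.
Qed.

(** The composition of two reflections moves the start of the curve to [u]. *)
Lemma hop_from u p q : hop p q -> exists2 v, u < v & hop_on u v p q.
Proof.
move=> [x [y [xy /(hop_on_reflect 0 (ltW xy)) h]]].
exists (u - x + y); first by lra.
have /(@hop_on_reflect _ _ (u - x)) : 0 - y <= 0 - x by lra.
move=> /(_ _ _ h); congr hop_on; lra.
Qed.

Lemma null_chain1 p q : hop p q -> null_chain p q `|q.1 - p.1|.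
Proof.
by move=> pq; rewrite -[X in null_chain _ _ X]addr0;
  apply: null_chain_hop pq (null_chain_refl q).
Qed.

Lemma null_chain_cat p q r l l' : null_chain p q l -> null_chain q r l' ->
  null_chain p r (l + l').
Proof.
move=> pq; elim: pq l' => {p q l} [p l'|p p' q l pp' _ ih l' qr].
  by rewrite add0r.
by rewrite -addrA; apply: null_chain_hop pp' (ih _ qr).
Qed.

Lemma null_chain_sym p q l : null_chain p q l -> null_chain q p l.
Proof.
elim=> {p q l} [p|p q r l pq _ ih]; first exact: null_chain_refl.
by rewrite addrC distrC; exact: null_chain_cat ih (null_chain1 (hop_sym pq)).
Qed.

Lemma piecewise_causal_cons u v w s al be :
  piecewise_causal_on f u v (w :: s) al be <->
  [/\ u < w, causal_piece f u w al be & piecewise_causal_on f w v s al be].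
Proof.
split=> [[[/= /andP[uw pws] lsv] pc]|[uw pc [[pws lsv] pcs]]].
  by split => //; [exact: (pc 0%N)|split => // i is_; exact: (pc i.+1)].
by split=> [|[//|i]]; [split => //=; rewrite uw|exact: (pcs i)].
Qed.

Lemma variation_cons u v w al s :
  variation u v al (w :: s) = `|al w - al u| + variation w v al s.
Proof. by rewrite /variation/= big_nat_recl. Qed.

Lemma piecewise_causal_congr u v s al al' be be' :
  {in `[u, v], al =1 al'} -> {in `[u, v], be =1 be'} ->
  piecewise_causal_on f u v s al be ->
  piecewise_causal_on f u v s al' be' /\ variation u v al s = variation u v al' s.
Proof.
elim: s u => [|w s ih] u aa' bb'.
  by move=> [? _]; split; [|rewrite !variation_nil].
move=> /piecewise_causal_cons[uw pc pcs].
have wv : w <= v by exact: itv_partition_le pcs.1.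
have sub_uw t : t \in `[u, w] -> t \in `[u, v].
  by rewrite !in_itv/= => /andP[? ?]; apply/andP; split; lra.
have sub_wv t : t \in `[w, v] -> t \in `[u, v].
  by rewrite !in_itv/= => /andP[? ?]; apply/andP; split; lra.
have [pcs' vs] := ih w (fun t tI => aa' t (sub_wv t tI))
  (fun t tI => bb' t (sub_wv t tI)) pcs.
split; last by rewrite !variation_cons vs !aa'// in_itv/=; apply/andP; split; lra.
apply/piecewise_causal_cons; split => //.
apply: causal_piece_congr pc; first exact: ltW.
  by move=> t /sub_uw /aa'.
by move=> t /sub_uw /bb'.
Qed.

Lemma null_chain_of_curve u v s al be :
  {in `[u, v], forall t, al t \in `[a, b]} ->
  piecewise_causal_on f u v s al be ->
  null_chain (al u, be u) (al v, be v) (variation u v al s).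
Proof.
elim: s u => [|w s ih] u alI.
  move=> [/itv_partition_nil -> _]; rewrite variation_nil.
  exact: null_chain_refl.
move=> /piecewise_causal_cons[uw pc pcs]; rewrite variation_cons.
have wv : w <= v by exact: itv_partition_le pcs.1.
apply: (@null_chain_hop _ (al w, be w)).
  exists u, w; split => //; exists al, be; split => // t; rewrite in_itv/= => ?.
  by apply: alI; rewrite in_itv/=; lra.
by apply: ih => // t tI; apply: alI; move: tI; rewrite !in_itv/=; lra.
Qed.

(** The tail of the chain is realized from the end point of the first hop on, so
    that gluing needs no change of parameter. *)
Lemma curve_of_null_chain p q l u : null_chain p q l -> p.1 \in `[a, b] ->
  exists v s al be, [/\ u < v, {in `[u, v], forall t, al t \in `[a, b]},
    piecewise_causal_on f u v s al be,
    [/\ al u = p.1, be u = p.2, al v = q.1 & be v = q.2]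
    & l = variation u v al s].
Proof.
move=> pq; elim: pq u => {p q l} [p|p q r l pq _ ih] u pI.
  (* A curve needs a nondegenerate interval, even to stay at a point. *)
  exists (u + 1), [:: u + 1], (fun=> p.1), (fun=> p.2); split => //.
  - by rewrite ltrDl.
  - apply/piecewise_causal_cons; split; first by rewrite ltrDl.
      by apply: Or31.
    by split; [split => //=|case].
  - by rewrite variation_cons variation_nil subrr normr0 addr0.
have [w uw [al1 [be1 [al1I pc1 [au bu aw bw]]]]] := hop_from u pq.
have [|v [s [al2 [be2 [wv al2I pc2 [aw2 bw2 av2 bv2] ->]]]]] := ih w.
  by rewrite -aw; apply: al1I; rewrite bound_itvE ltW.
pose al t := if t <= w then al1 t else al2 t.
pose be t := if t <= w then be1 t else be2 t.
have al1E : {in `[u, w], al1 =1 al}.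
  by move=> t; rewrite in_itv/= => /andP[_ tw]; rewrite /al tw.
have be1E : {in `[u, w], be1 =1 be}.
  by move=> t; rewrite in_itv/= => /andP[_ tw]; rewrite /be tw.
have al2E : {in `[w, v], al2 =1 al}.
  move=> t; rewrite in_itv/= /al => /andP[wt _]; case: ifP => // tw.
  have -> : t = w by lra.
  by rewrite aw2.
have be2E : {in `[w, v], be2 =1 be}.
  move=> t; rewrite in_itv/= /be => /andP[wt _]; case: ifP => // tw.
  have -> : t = w by lra.
  by rewrite bw2.
have [pc2' vE] := piecewise_causal_congr al2E be2E pc2.
exists v, (w :: s), al, be; split.
- exact: lt_trans wv.
- move=> t; rewrite in_itv/= => /andP[ut tv]; have [tw|/ltW wt] := leP t w.
    by rewrite -al1E ?al1I// in_itv/= ut tw.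
  by rewrite -al2E ?al2I// in_itv/= wt tv.
- apply/piecewise_causal_cons; split => //.
  exact: causal_piece_congr (ltW uw) al1E be1E pc1.
- by split; [rewrite -al1E|rewrite -be1E|rewrite -al2E|rewrite -be2E];
    rewrite ?bound_itvE ?ltW.
- by rewrite variation_cons vE -!al1E ?bound_itvE ?(ltW uw)// au aw.
Qed.

Lemma null_distE (p q : cone X a b) : null_dist f p q =
  ereal_inf [set l%:E | l in null_chain (val p.1, p.2) (val q.1, q.2)].
Proof.
congr ereal_inf; apply/seteqP; split => [l [u [v [s [al [be]]]]]|_ [l pq <-]].
  move=> [uv alI pc [<- <- <- <-] ->]; exists (variation u v al s) => //.
  exact: null_chain_of_curve.
have [|v [s [al [be [uv alI pc ends ->]]]]] := curve_of_null_chain 0 pq.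
  exact: (set_valP p.1).
by exists 0, v, s, al, be.
Qed.

End null_chains.

(** * From an almost everywhere speed bound to increments *)

Section cousin.
Context {R : realType}.

(** Cousin's lemma in the form of an induction principle on intervals. The
    supremum of the [q] such that [P u q] holds is reached and passed by an
    interval around it. *)
Lemma cousin (P : R -> R -> Prop) (u v : R) : u <= v ->
  (forall p q r, u <= p -> p <= q -> q <= r -> r <= v ->
     P p q -> P q r -> P p r) ->
  (forall s, u <= s -> s <= v -> exists2 d, 0 < d &
     forall p q, u <= p -> p <= s -> s <= q -> q <= v -> q - p < d -> P p q) ->
  P u v.
Proof.
move=> uv Pcat Ploc.
pose S : set R := [set q | [/\ u <= q, q <= v & P u q]].
have Su : S u.
  by split => //; have [d d0 dP] := Ploc u (lexx u) uv; apply: dP; rewrite ?subrr.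
have supS : has_sup S by split; [exists u|exists v => q []].
have uc : u <= sup S by apply: ub_le_sup => //; exact: supS.2.
have cv : sup S <= v by apply: ge_sup; [exists u|move=> q []].
have [d d0 dP] := Ploc (sup S) uc cv.
have [q [uq qv Pq] cq] := sup_adherent (divr_gt0 d0 (ltr0Sn _ 1)) supS.
have qc : q <= sup S by apply: ub_le_sup => //; exact: supS.2.
pose q' := Num.min v (sup S + d / 3).
have cq' : sup S <= q' by rewrite le_min cv lerDl divr_ge0// ltW.
have q'v : q' <= v by rewrite ge_min lexx.
have q'd : q' <= sup S + d / 3 by rewrite ge_min lexx orbT.
have Pq' : P u q'.
  by apply: (Pcat u q q') => //; [lra|apply: dP => //; lra].
have : q' <= sup S by apply: ub_le_sup; [exact: supS.2|split => //; lra].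
rewrite ge_min => /orP[vc|]; last by lra.
by have <- : q' = v by lra.
Qed.

End cousin.

Section speed_bound.
Context {R : realType} {X : metricType R}.
Local Notation mu := (@lebesgue_measure R).

(** A list of intervals within [p, q], ordered from left to right and with
    disjoint interiors. Lists are easier to concatenate than the indexed families of the
    definition of absolute continuity. *)
Fixpoint disjoint_itvs (p : R) (l : seq (R * R)) (q : R) : Prop :=
  if l is xy :: l' then [/\ p <= xy.1, xy.1 <= xy.2 & disjoint_itvs xy.2 l' q]
  else p <= q.

Lemma disjoint_itvs_le p l q : disjoint_itvs p l q -> p <= q.
Proof.
elim: l p => [//|xy l ih] p /= [pq xy12 /ih]; exact: le_trans (le_trans pq xy12).
Qed.

Lemma disjoint_itvs_cat p l q l' r : disjoint_itvs p l q ->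
  disjoint_itvs q l' r -> disjoint_itvs p (l ++ l') r.
Proof.
elim: l p => [|xy l ih] p /=; last by move=> [px xy12 lq] /(ih _ lq).
case: l' => [|xy l'] /=; first exact: le_trans.
by move=> pq [qx xy12 l'r]; split => //; exact: le_trans qx.
Qed.

Lemma disjoint_itvs_nth z p l q i : disjoint_itvs p l q -> (i < size l)%N ->
  [/\ p <= (nth z l i).1, (nth z l i).1 <= (nth z l i).2 & (nth z l i).2 <= q].
Proof.
elim: l p i => [//|xy l ih] p [|i] /= [px xy12 lq].
  by split => //; exact: disjoint_itvs_le lq.
rewrite ltnS => /(ih _ _ lq)[h1 h2 h3]; split => //.
exact: le_trans (le_trans px xy12) h1.
Qed.

Lemma disjoint_itvs_lt z p l q i j : disjoint_itvs p l q -> (i < j < size l)%N ->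
  (nth z l i).2 <= (nth z l j).1.
Proof.
elim: l p i j => [|xy l ih] p i [|j] //=; rewrite ?andbF// => -[px xy12 lq].
case: i => [|i] /=; last by rewrite !ltnS => ij; exact: ih lq ij.
by rewrite ltnS => jl; have [] := disjoint_itvs_nth z lq jl.
Qed.

Lemma abs_continuous_disjoint_itvs (u v e : R) (c : R -> X) :
  abs_continuous u v c -> 0 < e -> exists2 d, 0 < d &
    forall l, disjoint_itvs u l v -> \sum_(xy <- l) (xy.2 - xy.1) < d ->
      \sum_(xy <- l) mdist (c xy.1) (c xy.2) < e.
Proof.
move=> cac e0; have [d d0 dP] := cac e e0; exists d => // l ld.
rewrite !(big_nth (0, 0)) !big_mkord; apply: dP => [i|i j _ _ [s [/= si sj]]].
  exact: disjoint_itvs_nth ld (ltn_ord i).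
move: si sj; rewrite !in_itv/= => /andP[? ?] /andP[? ?].
apply/eqP; rewrite -val_eqE; case: ltngtP => // ij; exfalso.
  have := disjoint_itvs_lt (0, 0) ld (i := i) (j := j).
  by rewrite ij ltn_ord => /(_ isT); lra.
have := disjoint_itvs_lt (0, 0) ld (i := j) (j := i).
by rewrite ij ltn_ord => /(_ isT); lra.
Qed.

Lemma null_set_open_cover (A : set R) (d : R) : measurable A -> mu A = 0%E ->
  0 < d -> exists U : set R, [/\ open U, A `<=` U & (mu U < d%:E)%E].
Proof.
move=> mA A0 d0.
have Aoo : (mu A < +oo)%E by rewrite A0 ltry.
have [U [oU AU Ud]] := lebesgue_regularity_outer mA Aoo d0.
exists U; split => //; rewrite -(setDUK AU) setUC measureU0//.
by apply: measurableD => //; exact: open_measurable.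
Qed.

(** Subintervals tagged at a point where the speed bound holds have increments
    bounded by those of [g], up to [e] times their length. The other
    subintervals are contained in an open set of measure less than the modulus
    of absolute continuity, so their increments sum up to less than [e]. The
    induction carries the list of these exceptional subintervals. *)
Lemma speed_bound (u v m : R) (g : R -> R) (c : R -> X) : u <= v -> 0 <= m ->
  abs_continuous u v c ->
  (forall s t, u <= s -> s <= t -> t <= v -> g s <= g t) ->
  {ae mu, forall s : R, s \in `]u, v[ ->
    forall e, 0 < e -> exists2 d, 0 < d & forall t, u <= t <= v -> `|t - s| < d ->
      m * mdist (c t) (c s) <= `|g t - g s| + e * `|t - s|} ->
  m * mdist (c u) (c v) <= g v - g u.
Proof.
move=> uv m0 cac gmono [A [mA A0 PA]].
(* The error terms are made proportional to a single [e]. *)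
suff bound e : 0 < e -> m * mdist (c u) (c v) <= g v - g u + e * (v - u) + m * e.
  apply/ler_addgt0Pl => e e0.
  have k0 : 0 < v - u + m + 1 by rewrite ltr_pwDr// addr_ge0// subr_ge0.
  apply: le_trans (bound (e / (v - u + m + 1)) (divr_gt0 e0 k0)) _.
  rewrite -addrA addrC lerD2r [m * _]mulrC -mulrDr.
  by rewrite -mulrA ger_pMr// ler_pdivrMl// mulr1 lerDl.
move=> e0.
have [d d0 dP] := abs_continuous_disjoint_itvs cac e0.
(* The end points are added to the exceptional set, for lack of a two-sided
   neighbourhood. *)
have muv : measurable ([set u] `|` [set v]).
  by apply: measurableU; exact: measurable_set1.
have uv0 : mu ([set u] `|` [set v]) = 0%E.
  by rewrite measureU0; do ?[exact: measurable_set1|exact: lebesgue_measure_set1].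
have mA' : measurable (A `|` ([set u] `|` [set v])) by exact: measurableU.
have A'0 : mu (A `|` ([set u] `|` [set v])) = 0%E by rewrite measureU0.
have [U [oU AU Ud]] := null_set_open_cover mA' A'0 d0.
have mU : measurable U by exact: open_measurable.
pose P p q := exists l, [/\ disjoint_itvs p l q,
  ((\sum_(xy <- l) (xy.2 - xy.1))%:E <= mu (U `&` `]p, q]))%E
  & m * mdist (c p) (c q) <= g q - g p + e * (q - p) +
      m * \sum_(xy <- l) mdist (c xy.1) (c xy.2)].
have [||l [ld lU lm]] := @cousin R P u v uv.
- move=> p q r up pq qr rv [l [ld lU lm]] [l' [ld' lU' lm']].
  exists (l ++ l'); split; first exact: disjoint_itvs_cat ld ld'.
    have -> : U `&` `]p, r] = (U `&` `]p, q]) `|` (U `&` `]q, r]).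
      rewrite -setIUr; congr setI; apply/seteqP; split => s /=; rewrite !in_itv/=.
        by move=> /andP[ps sr]; have [sq|qs] := leP s q; [left|right];
          apply/andP; split.
      by move=> [|] /andP[? ?]; apply/andP; split; lra.
    rewrite measureU//=; last 3 first.
    - exact: measurableI.
    - exact: measurableI.
    - apply/seteqP; split => s //= [[_]]; rewrite !in_itv/= => /andP[_ sq] [_].
      by move=> /andP[qs _]; lra.
    by rewrite big_cat/= EFinD leeD.
  rewrite big_cat/= mulrDr.
  have t1 := metric_triangle (c p) (c q) (c r).
  have := ler_wpM2l m0 t1; rewrite mulrDr; lra.
- move=> s us sv.
  have [sA|sA] := pselect ((A `|` ([set u] `|` [set v])) s).
    have /nbhs_ballP[r /= r0 rU] : nbhs s U by apply: open_nbhs_nbhs; split => //; exact: AU.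
    exists r => // p q up ps sq qv qpr; exists [:: (p, q)]; split => /=.
    + by split => //; exact: le_trans sq.
    + rewrite big_seq1/= setIidr => [|t /=]; last first.
        by rewrite in_itv/= => /andP[? ?]; apply: rU; rewrite /ball/= ltr_norml; lra.
      rewrite lebesgue_measure_itv/= lte_fin; case: ltP => // qp.
      by rewrite lee_fin subr_le0.
    + rewrite big_seq1/= lerDr; have pq := le_trans ps sq.
      by rewrite addr_ge0 ?mulr_ge0 ?subr_ge0 ?gmono ?(ltW e0).
  have sI : s \in `]u, v[.
    rewrite in_itv/= !lt_neqAle us sv !andbT; apply/andP.
    by split; apply: contra_notN sA => /eqP e1; right; [left|right].
  have Gs : forall e, 0 < e -> exists2 d, 0 < d & forall t, u <= t <= v ->
      `|t - s| < d -> m * mdist (c t) (c s) <= `|g t - g s| + e * `|t - s|.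
    by apply: contrapT => nG; apply: sA; left; apply: PA => /(_ sI).
  have [r r0 rP] := Gs e e0.
  exists r => // p q up ps sq qv qpr; exists [::]; split; rewrite ?big_nil.
  + exact: le_trans sq.
  + exact: measure_ge0.
  + have h1 : m * mdist (c p) (c s) <= g s - g p + e * (s - p).
      have := rP p; rewrite up (le_trans ps) ?(le_trans sq)//= => /(_ isT).
      rewrite ler0_norm ?subr_le0// opprB ler0_norm ?subr_le0; last exact: gmono.
      by rewrite opprB; apply; lra.
    have h2 : m * mdist (c s) (c q) <= g q - g s + e * (q - s).
      have := rP q; rewrite qv (le_trans up) ?(le_trans ps)//= => /(_ isT).
      rewrite ger0_norm ?subr_ge0// ger0_norm ?subr_ge0; last exact: gmono.
      by rewrite metric_sym; apply; lra.
    have t1 := metric_triangle (c p) (c s) (c q).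
    have := ler_wpM2l m0 t1; rewrite mulrDr; lra.
- apply: le_trans lm _; rewrite lerD2l ler_wpM2l// ltW// dP//.
  rewrite -lte_fin (le_lt_trans lU)// (le_lt_trans _ Ud)// le_measure ?inE//.
  by apply: measurableI.
Qed.

End speed_bound.

(** * Bounds for null lengths *)

Section null_dist_lower_bound.
Context {R : realType} {X : metricType R}.
Implicit Types (f al : R -> R) (be : R -> X).

(** Where both derivatives exist, causality reads [f |w| <= |a'|], and [m <= f]
    turns this into an infinitesimal comparison of increments. *)
Lemma causal_speed f (s a' w m e : R) al be : 0 < m -> m <= f (al s) ->
  is_derive s 1 al a' -> is_metric_derivative be s w ->
  - a' ^+ 2 + f (al s) ^+ 2 * w ^+ 2 <= 0 -> 0 < e ->
  exists2 d, 0 < d & forall t, `|t - s| < d ->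
    m * mdist (be t) (be s) <= `|al t - al s| + e * `|t - s|.
Proof.
move=> m0 mf da mw ineq e0.
have fw : f (al s) * `|w| <= `|a'|.
  have f0 : 0 <= f (al s) by exact: le_trans (ltW m0) mf.
  rewrite -(@ler_pXn2r _ 2) ?nnegrE ?mulr_ge0//.
  by rewrite exprMn !real_normK ?num_real//; lra.
have mwa : m * w <= `|a'|.
  apply: le_trans fw; apply: (@le_trans _ _ (m * `|w|)).
    by rewrite ler_wpM2l ?ler_norm ?ltW.
  by rewrite ler_wpM2r.
have e'0 : 0 < e / (m + 1) by rewrite divr_gt0// ltr_wpDr// ltW.
have [d d0 dP] := is_derive_approx da e'0.
have [d' d'0 d'P] := (is_metric_derivativeP be s w).1 mw _ e'0.
exists (Num.min d d'); first by rewrite lt_min d0.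
move=> t; rewrite lt_min => /andP[td td'].
have [->|ts] := eqVneq t s; first by rewrite mdistxx !subrr !normr0 !mulr0 addr0.
have h0 : t - s != 0 by rewrite subr_eq0.
have := dP _ h0 td; have := d'P _ h0 td'.
rewrite (_ : s + (t - s) = t); last by lra.
set r := `|t - s|; set k := e / (m + 1) => h1 h2.
have r0 : 0 <= r by exact: normr_ge0.
have kE : k * m + k = e by rewrite -{2}[k]mulr1 -mulrDr divfK// gt_eqF// ltr_wpDr// ltW.
have h3 : `|a'| * r <= `|al t - al s| + k * r.
  rewrite -normrM; apply: le_trans (lerD (lexx _) h2).
  have := ler_normB (al t - al s) (al t - al s - a' * (t - s)).
  by rewrite subKr.
have h4 : mdist (be t) (be s) <= w * r + k * r.
  by have := le_trans (ler_norm _) h1; lra.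
have h5 := ler_wpM2l (ltW m0) h4.
have h6 := ler_wpM2r r0 mwa.
by rewrite -kE; lra.
Qed.

(** The time component is strictly monotone, so up to sign it can serve as the
    nondecreasing function [g] of [speed_bound]. *)
Lemma causal_dist_le f (a b u v m : R) al be : u <= v -> 0 < m ->
  {in `[a, b], forall t, m <= f t} ->
  {in `[u, v], forall t, al t \in `[a, b]} -> causal f u v al be ->
  m * mdist (be u) (be v) <= `|al v - al u|.
Proof.
move=> uv m0 mf alI [_ beac mono ae].
have bound (g : R -> R) : (forall s t, `|g t - g s| = `|al t - al s|) ->
    (forall s t, u <= s -> s <= t -> t <= v -> g s <= g t) ->
    m * mdist (be u) (be v) <= `|al v - al u|.
  move=> gal gmono; rewrite -gal ger0_norm ?subr_ge0; last exact: gmono.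
  apply: speed_bound => //; first exact: ltW.
  apply: ae_mono ae => s sP suv e e0; have [a' [w [da mw ineq]]] := sP suv.
  have [d d0 dP] := causal_speed m0 (mf _ (alI s (subset_itv_oo_cc suv))) da mw ineq e0.
  by exists d => // t _ td; rewrite gal; exact: dP.
case: mono => mono.
  apply: (bound al) => // s t us; rewrite le_eqVlt => /predU1P[->//|st] tv.
  by apply/ltW/mono => //; rewrite in_itv/=; lra.
apply: (bound (\- al)) => [s t|s t us].
  by rewrite /= -opprD normrN.
rewrite le_eqVlt => /predU1P[->//|st] tv.
by rewrite /= lerN2; apply/ltW/mono => //; rewrite in_itv/=; lra.
Qed.

(** The first bound separates points with different times and the second one
    points of the same slice. *)
Lemma null_chain_ge f (a b m : R) (p q : R * X) (l : R) : 0 < m ->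
  {in `[a, b], forall t, m <= f t} -> null_chain f a b p q l ->
  `|q.1 - p.1| <= l /\ m * mdist p.2 q.2 <= l.
Proof.
move=> m0 mf; elim=> {p q l} [p|p q r l [u [v [uv [al [be [alI pc ends]]]]]] _ [ih1 ih2]].
  by rewrite subrr normr0 mdistxx mulr0.
split; first by rewrite [leRHS]addrC (le_trans (ler_distD q.1 _ _))// lerD2r.
have pq : m * mdist p.2 q.2 <= `|q.1 - p.1|.
  case: ends => <- <- <- <-; case: pc => [cst|[c _]|[c _]].
  - have [|_ ->] := cst v; first by rewrite bound_itvE ltW.
    by rewrite mdistxx mulr0.
  - exact: causal_dist_le (ltW uv) m0 mf alI c.
  - exact: causal_dist_le (ltW uv) m0 mf alI c.
have t1 := metric_triangle p.2 q.2 r.2.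
by have := ler_wpM2l (ltW m0) t1; rewrite mulrDr; lra.
Qed.

End null_dist_lower_bound.

Section null_dist_upper_bound.
Context {R : realType} {X : metricType R} (f : R -> R) (a b C : R).
Hypothesis (ab : a < b) (C0 : 0 < C).
Hypothesis f_gt0 : {in `[a, b], forall t, 0 < f t}.
Hypothesis f_le : {in `[a, b], forall t, f t <= C}.
Hypothesis cptX : compact [set: X].
Hypothesis lenX : length_space X.
Implicit Types (p q : R * X) (x y : X).

(** Along a constant speed geodesic with linear time both derivatives are
    constant and the causality condition is the hypothesis on the distance. The
    times have to differ, since a causal curve has a strictly monotone time. *)
Lemma hop_of_dist_le p q : p.1 \in `[a, b] -> q.1 \in `[a, b] -> p.1 != q.1 ->
  C * mdist p.2 q.2 <= `|q.1 - p.1| -> hop f a b p q.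
Proof.
case: p q => [t x] [t' y] /= tI t'I tt' Cxy.
have [g [g0 gL gE]] := geodesic cptX lenX x y.
set L := mdist x y in Cxy gL gE; have L0 : 0 <= L by exact: mdist_ge0.
set D := t' - t in Cxy; have D0 : D != 0 by rewrite subr_eq0 eq_sym.
pose al s := t + D * s; pose be s := g (L * s).
have alI : {in `[0, 1], forall s, al s \in `[a, b]}.
  move: tI t'I; rewrite !in_itv/= => /andP[ta tb] /andP[ta' tb'] s.
  rewrite !in_itv/= => /andP[s0 s1].
  have s1' : 0 <= 1 - s by lra.
  rewrite -subr_ge0 in ta; rewrite -subr_ge0 in ta'.
  rewrite -subr_ge0 in tb; rewrite -subr_ge0 in tb'.
  have := mulr_ge0 s0 ta'; have := mulr_ge0 s1' ta.
  have := mulr_ge0 s0 tb'; have := mulr_ge0 s1' tb.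
  by rewrite /al /D => ? ? ? ?; apply/andP; split; lra.
have LI s : 0 <= s -> s <= 1 -> 0 <= L * s <= L.
  by move=> s0 s1; rewrite mulr_ge0//= ler_piMr.
have beE s s' : 0 <= s -> s <= 1 -> 0 <= s' -> s' <= 1 ->
    mdist (be s) (be s') = L * `|s - s'|.
  by move=> *; rewrite gE ?LI// -mulrBr normrM ger0_norm.
have c : causal f 0 1 al be.
  split.
  - apply: (@abs_continuous_lipschitz R R^o _ _ _ `|D|) => s s' s0 ss' s'1.
    rewrite /mdist/= /al opprD addrACA subrr add0r -mulrBr normrM.
    by rewrite [`|s' - s|]ger0_norm// subr_ge0.
  - apply: (@abs_continuous_lipschitz _ _ _ _ _ L) => s s' s0 ss' s'1.
    rewrite beE// ?(le_trans s0)// ?(le_trans ss')// distrC ger0_norm//.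
    by rewrite subr_ge0.
  - move: D0; rewrite neq_lt => /orP[Dlt|Dgt]; [right|left] => s s' _ _ ss'.
      by rewrite /al ltrD2l ltr_nM2l.
    by rewrite /al ltrD2l ltr_pM2l.
  - exists set0; split; [exact: measurable0|exact: measure0|].
    move=> s /=; apply => s01; exists D, L; split.
    + have := is_deriveD (is_derive_cst t s (1 : R))
        (is_deriveZ D (is_derive_id s (1 : R))).
      by rewrite add0r [_ *: _]mulr1.
    + apply/is_metric_derivativeP => e e0; move: s01; rewrite in_itv/=.
      move=> /andP[s0 s1]; exists (Num.min s (1 - s)).
        by rewrite lt_min s0 subr_gt0.
      move=> h h0; rewrite lt_min !ltr_norml => /andP[/andP[h1 h2] /andP[h3 h4]].
      rewrite beE; [|lra..].
      by rewrite addrAC subrr add0r subrr normr0 mulr_ge0// ltW.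
    + have sI := alI s (subset_itv_oo_cc s01).
      rewrite addrC subr_le0 -exprMn -[leRHS]real_normK ?num_real//.
      rewrite ler_pXn2r ?nnegrE ?mulr_ge0 ?(ltW (f_gt0 sI))//.
      by apply: le_trans Cxy; rewrite ler_wpM2r// f_le.
exists 0, 1; split => //; exists al, be; split => //.
- move: D0; rewrite neq_lt => /orP[Dlt|Dgt]; [apply: Or33|apply: Or32];
    split => //; exists set0; split; do ?[exact: measurable0|exact: measure0];
    move=> s /=; apply => s01; exists D => //.
  + have := is_deriveD (is_derive_cst t s (1 : R))
      (is_deriveZ D (is_derive_id s (1 : R))).
    by rewrite add0r [_ *: _]mulr1.
  + have := is_deriveD (is_derive_cst t s (1 : R))
      (is_deriveZ D (is_derive_id s (1 : R))).
    by rewrite add0r [_ *: _]mulr1.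
- by rewrite /al /be !mulr0 !mulr1 addr0 g0 gL /D addrC subrK.
Qed.

Lemma vertical_chain (t t' : R) x : t \in `[a, b] -> t' \in `[a, b] ->
  null_chain f a b (t, x) (t', x) `|t' - t|.
Proof.
move=> tI t'I; have [<-|tt'] := eqVneq t t'.
  by rewrite subrr normr0; exact: null_chain_refl.
by apply/null_chain1/hop_of_dist_le => //=; rewrite mdistxx mulr0.
Qed.

(** One tooth of the zigzag: go to [y] while the time moves by [C * mdist x y],
    upwards or downwards so as to stay in [a, b], then come back in time. The
    bound by half the length of [a, b] makes one of the directions possible. *)
Lemma horizontal_chain_short (t : R) x y : t \in `[a, b] ->
  C * mdist x y <= (b - a) / 2 ->
  null_chain f a b (t, x) (t, y) (2 * C * mdist x y).
Proof.
move=> tI Cxy.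
have [<-|xy] := eqVneq x y; first by rewrite mdistxx mulr0; exact: null_chain_refl.
have D0 : 0 < C * mdist x y by rewrite mulr_gt0// mdist_gt0.
set D := C * mdist x y in Cxy D0.
have [t' [t'I tD]] : exists t', t' \in `[a, b] /\ `|t' - t| = D.
  move: tI; rewrite in_itv/= => /andP[ta tb].
  have [tDb|tDb] := leP (t + D) b.
    exists (t + D); rewrite in_itv/= tDb addrAC subrr add0r gtr0_norm//.
    by rewrite (le_trans ta)// lerDl ltW.
  exists (t - D); rewrite in_itv/= addrAC subrr add0r normrN gtr0_norm//.
  by split => //; apply/andP; split; lra.
have tt' : t != t' by rewrite -subr_eq0 -normr_eq0 distrC tD gt_eqF.
have -> : 2 * C * mdist x y = `|t' - t| + `|t - t'|.
  by rewrite (distrC t t') tD /D; lra.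
apply: null_chain_cat (vertical_chain _ _ _) => //.
by apply: null_chain1; apply: hop_of_dist_le => //=; rewrite tD.
Qed.

(** Distances are halved with midpoints until one tooth suffices; the bound is
    additive along geodesics. *)
Lemma horizontal_chain (t : R) x y : t \in `[a, b] ->
  null_chain f a b (t, x) (t, y) (2 * C * mdist x y).
Proof.
move=> tI; have ba0 : 0 < (b - a) / 2 by rewrite divr_gt0// subr_gt0.
suff dyadic n x' y' : C * mdist x' y' <= 2 ^+ n * ((b - a) / 2) ->
    null_chain f a b (t, x') (t, y') (2 * C * mdist x' y').
  pose n := Num.truncn (C * mdist x y / ((b - a) / 2)).
  apply: (dyadic n.+1); rewrite -ler_pdivrMr//.
  apply: (@le_trans _ _ n.+1%:R); first by rewrite ltW// truncnS_gt.
  by rewrite -natrX ler_nat ltnW// ltn_expl.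
elim: n x' y' => [|n ih] x' y' xy; first by apply: horizontal_chain_short; rewrite // mul1r in xy.
have [g [g0 gL gE]] := geodesic cptX lenX x' y'.
set L := mdist x' y' in xy gL gE *; have L0 : 0 <= L by exact: mdist_ge0.
have xz : mdist x' (g (L / 2)) = L / 2.
  by rewrite -{1}g0 gE ?sub0r ?normrN ?ger0_norm ?lexx//; [|apply/andP; split]; lra.
have zy : mdist (g (L / 2)) y' = L / 2.
  have Ld : `|L / 2 - L| = L / 2 by rewrite distrC ger0_norm; lra.
  by rewrite -{1}gL gE ?Ld ?lexx ?L0//; apply/andP; split; lra.
have half : C * (L / 2) <= 2 ^+ n * ((b - a) / 2).
  by move: xy; rewrite exprS; lra.
have -> : 2 * C * L = 2 * C * mdist x' (g (L / 2)) + 2 * C * mdist (g (L / 2)) y'.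
  by rewrite xz zy -mulrDr -splitr.
by apply: null_chain_cat (ih _ _ _) (ih _ _ _); rewrite ?xz ?zy.
Qed.

Lemma null_chain_exists p q : p.1 \in `[a, b] -> q.1 \in `[a, b] ->
  null_chain f a b p q (`|q.1 - p.1| + 2 * C * mdist p.2 q.2).
Proof.
case: p q => [t x] [t' y] /= tI t'I.
exact: null_chain_cat (vertical_chain x tI t'I) (horizontal_chain x y t'I).
Qed.

End null_dist_upper_bound.

(** * Cones with the null distance *)

Section cone_metric.
Context {R : realType} {X : metricType R} (a b : R).

(** This pseudo-distance depends on [f] only through the upper bound [C]. *)
Definition cone_dist (C : R) (p q : cone X a b) : R :=
  `|val q.1 - val p.1| + 2 * C * mdist p.2 q.2.

Lemma cone_dist_compact (C : R) : 0 < C -> compact [set: X] ->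
  dist_compact (cone_dist C).
Proof.
move=> C0 cptX U UU.
have [t tI tU] := @ultra_cvg_compact _ R `[a, b]%classic
  (fun p : cone X a b => val p.1) U UU (@segment_compact _ a b)
  (fun p => set_valP p.1).
have [//|x _ xU] := @ultra_cvg_compact _ X setT
  (fun p : cone X a b => p.2) U UU cptX.
exists (SigSub (mem_set tI) : `[a, b]%classic, x) => e e0; rewrite /cone_dist/=.
have e2 : 0 < e / 2 by rewrite divr_gt0.
have eC : 0 < e / 2 / (2 * C) by rewrite !divr_gt0// mulr_gt0.
near=> p.
have h1 : `|t - val p.1| < e / 2 by near: p; move/cvgrPdist_lt : tU => /(_ _ e2).
have : mdist p.2 x < e / 2 / (2 * C) by near: p; exact: (cvg_mdist xU eC).
rewrite ltr_pdivlMr ?mulr_gt0// mulrC => h2; lra.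
Unshelve. all: by end_near. Qed.

Section null_distance.
Variables (f : R -> R) (C : R).
Hypothesis (ab : a < b) (C0 : 0 < C).
Hypothesis f_cont : {within `[a, b], continuous f}.
Hypothesis f_gt0 : {in `[a, b], forall t, 0 < f t}.
Hypothesis f_le : {in `[a, b], forall t, f t <= C}.
Hypothesis cptX : compact [set: X].
Hypothesis lenX : length_space X.
Implicit Types p q r : cone X a b.

Let chains p q : set R := [set l | null_chain f a b (val p.1, p.2) (val q.1, q.2) l].

Definition null_dist_real p q : R := inf (chains p q).

Let f_min : exists2 m, 0 < m & {in `[a, b], forall t, m <= f t}.
Proof.
have [c cI cmin] := EVT_min (ltW ab) f_cont.
by exists (f c) => //; exact: f_gt0.
Qed.

Let chain_le p q : chains p q (cone_dist C p q).
Proof.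
by apply: (null_chain_exists ab C0 f_gt0 f_le cptX lenX
  (p := (val p.1, p.2)) (q := (val q.1, q.2)));
  [exact: (set_valP p.1)|exact: (set_valP q.1)].
Qed.

Let chains_ge0 p q : lbound (chains p q) 0.
Proof.
move=> l pq; have [m m0 mf] := f_min.
exact: le_trans (null_chain_ge m0 mf pq).1.
Qed.

Let chains_inf p q : has_inf (chains p q).
Proof. by split; [exists (cone_dist C p q)|exists 0; exact: chains_ge0]. Qed.

Lemma null_dist_realE p q : null_dist f p q = (null_dist_real p q)%:E.
Proof.
rewrite null_distE ereal_inf_EFin//; first exact: (chains_inf p q).2.
exact: (chains_inf p q).1.
Qed.

Lemma null_dist_real_le_chain p q l : chains p q l -> null_dist_real p q <= l.
Proof. by move=> pq; apply: ge_inf => //; exact: (chains_inf p q).2. Qed.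

Lemma null_dist_real_le p q : null_dist_real p q <= cone_dist C p q.
Proof. exact: null_dist_real_le_chain. Qed.

Lemma null_dist_real_adherent p q e : 0 < e ->
  exists2 l, chains p q l & l < null_dist_real p q + e.
Proof. by move=> e0; exact: inf_adherent. Qed.

Lemma null_dist_real_pseudo : pseudo_dist null_dist_real.
Proof.
have ge0 p q : 0 <= null_dist_real p q.
  by apply: lb_le_inf; [exact: (chains_inf p q).1|exact: chains_ge0].
have sym p q : null_dist_real p q <= null_dist_real q p.
  apply/ler_addgt0Pl => e e0; have [l ql le] := null_dist_real_adherent q p e0.
  rewrite addrC (le_trans _ (ltW le))//.
  by apply: null_dist_real_le_chain; exact: null_chain_sym.
split.
- move=> p; apply/eqP; rewrite eq_le ge0 andbT.
  by apply: null_dist_real_le_chain; exact: null_chain_refl.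
- by move=> p q; apply/eqP; rewrite eq_le !sym.
- move=> q p r; apply/ler_addgt0Pl => e e0.
  have e2 : 0 < e / 2 by rewrite divr_gt0.
  have [l pq le] := null_dist_real_adherent p q e2.
  have [l' qr le'] := null_dist_real_adherent q r e2.
  have := null_dist_real_le_chain (null_chain_cat pq qr : chains p r _); lra.
Qed.

(** This is where continuity of [f] enters: its minimum is positive. *)
Lemma null_dist_real_eq0 p q : null_dist_real p q = 0 -> p = q.
Proof.
move=> pq0; have [m m0 mf] := f_min.
have small e : 0 < e -> `|val q.1 - val p.1| <= e /\ m * mdist p.2 q.2 <= e.
  move=> e0; have [l pq le] := null_dist_real_adherent p q e0.
  rewrite pq0 add0r in le; have [h1 h2] := null_chain_ge m0 mf pq.
  by split; [exact: le_trans h1 (ltW le)|exact: le_trans h2 (ltW le)].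
have pq1 : p.1 = q.1.
  apply: val_inj; apply/eqP; rewrite eq_sym -subr_eq0 -normr_le0.
  by apply/ler_addgt0Pl => e e0; rewrite addr0; exact: (small e e0).1.
have pq2 : p.2 = q.2.
  apply: mdist_positivity; apply/eqP; rewrite eq_le mdist_ge0 andbT.
  rewrite -(@ler_pM2l _ m)// mulr0.
  by apply/ler_addgt0Pl => e e0; rewrite addr0; exact: (small e e0).2.
by rewrite (surjective_pairing p) pq1 pq2 -surjective_pairing.
Qed.

Lemma cone_space_exists : exists A : compact_metric R, is_cone_space X a b f A.
Proof.
have [A [pi [[pis _] piE]]] := short_quotient_of_dist (cone_dist_compact C0 cptX)
  null_dist_real_pseudo null_dist_real_le.
exists A, pi; last by move=> p q; rewrite null_dist_realE piE.
have /choice[s sK] := pis; exists s => // p.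
by apply: null_dist_real_eq0; rewrite -piE sK mdistxx.
Qed.

Lemma cone_space_short_quotient (A : compact_metric R) :
  is_cone_space X a b f A -> short_quotient (cone_dist C) A.
Proof.
move=> [phi [psi _ psiK] phiE]; exists phi; split.
  by move=> x; exists (psi x); exact: psiK.
by move=> p q; rewrite -lee_fin phiE null_dist_realE lee_fin null_dist_real_le.
Qed.

End null_distance.

End cone_metric.

Theorem theorem4p16 (R : realType) (a b : R) (ab : a < b)
    (X : metricType R) (cptX : compact [set: X]) (lenX : length_space X)
    (F : set (R -> R))
    (F_cont : forall f, F f -> {within `[a, b], continuous f})
    (F_pos : forall f, F f -> {in `[a, b], forall t, 0 < f t})
    (F_bound : exists2 C : R, 0 < C &
       forall f, F f -> {in `[a, b], forall t, f t <= C}) :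
  [/\ forall f, F f -> exists A : compact_metric R, is_cone_space X a b f A,
      gh_precompact (cone_spaces X a b F)
    & forall Y : nat -> compact_metric R,
        (forall n, cone_spaces X a b F (Y n)) ->
        exists (k : nat -> nat) (Z : compact_metric R),
          {homo k : m n / (m < n)%N} /\
          (fun n => gh_dist (Y (k n)) Z) @ \oo --> 0%E].
Proof.
have [C C0 FC] := F_bound.
have Dc := @cone_dist_compact R X a b C C0 cptX.
have short A : cone_spaces X a b F A -> 
    short_quotient (cone_dist C : cone X a b -> cone X a b -> R) A.
  move=> [f Ff]; apply: (cone_space_short_quotient ab C0 (F_cont f Ff)
    (F_pos f Ff) (FC f Ff) cptX lenX).
split.
- move=> f Ff; exact: (cone_space_exists ab C0 (F_cont f Ff) (F_pos f Ff)
    (FC f Ff) cptX lenX).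
- exact: (short_quotient_gh_precompact Dc short).
- move=> Y YF; apply: (short_quotient_subsequence Dc) => n; exact: short.
Qed.
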